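(* Let $m,n\ge 1$ be integers, let $m_0=\lceil m/2\rceil$, and let $\mathcal{A}\in \mathtt{S}^m(\mathbb{R}^n)$ be an arbitrary real symmetric tensor. Let $v^*$, the semidefinite programs $(P_k)$ with optimal values $v_k$, the semidefinite programs $(Q_k)$, and the Algorithm be as defined in the context. Then: (i) For all $k\ge m_0$, the semidefinite program $(P_k)$ is feasible and achieves its optimal value $v_k$; moreover, $v_k=v^*$ for all $k$ sufficiently large. (ii) For all $k\ge m_0$, the semidefinite program $(Q_k)$ has an optimizer if it is feasible. (iii) If $\mathcal{A}$ is copositive, then the Algorithm must stop with $v_k\ge 0$ when $k$ is sufficiently large (that is, it terminates in Step 1 at some finite order $k$ with $v_k\ge 0$). (iv) If $\mathcal{A}$ is not copositive, then, for almost all $\xi\in\mathbb{R}^{\mathbb{N}^n_m}$ (with respect to Lebesgue measure), the Algorithm must stop with $\mathcal{A}(u)<0$ and $u\in\Delta$ when $k$ is sufficiently large (that is, it terminates in Step 3 at some finite order $k$, with a point $u\in\Delta$ such that $\mathcal{A}(u)<0$).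
   Context: **Tensors.** $\mathtt{S}^m(\mathbb{R}^n)$ is the space of real symmetric tensors $\mathcal{A}=(\mathcal{A}_{i_1\ldots i_m})_{1\le i_1,\ldots,i_m\le n}$ of order $m$ (entries invariant under permutation of the indices). For such $\mathcal{A}$, let $$\mathcal{A}(x)=\sum_{1\le i_1,\ldots,i_m\le n}\mathcal{A}_{i_1\cdots i_m}x_{i_1}\cdots x_{i_m},\qquad x=(x_1,\ldots,x_n),$$ a form of degree $m$. $\mathcal{A}$ is copositive if $\mathcal{A}(x)\ge 0$ for all $x\in\mathbb{R}^n_+$ (the nonnegative orthant). Let $e$ be the all-ones vector in $\mathbb{R}^n$, $e_i$ the $i$th standard unit vector, $\|\cdot\|$ the Euclidean norm, and $$\Delta=\{x\in\mathbb{R}^n: e^Tx=1,\ x\ge 0\},\qquad v^*=\min_{x\in\Delta}\mathcal{A}(x).$$ Define the polynomials $$p_i(x)=\frac{\partial \mathcal{A}(x)}{\partial x_i}-m\,\mathcal{A}(x),\qquad i=1,\ldots,n.$$ **Moments and localizing matrices.** For $d\in\mathbb{N}$, $\mathbb{N}^n_d=\{\alpha\in\mathbb{N}^n:|\alpha|\le d\}$ where $|\alpha|=\alpha_1+\cdots+\alpha_n$ and $\mathbb{N}$ is the set of nonnegative integers. $\mathbb{R}^{\mathbb{N}^n_d}$ is the space of real vectors $y=(y_\alpha)_{\alpha\in\mathbb{N}^n_d}$, and $y_0$ denotes the entry for $\alpha=0$. For a polynomial $f=\sum_\alpha f_\alpha x^\alpha$ of degree at most $d$ and $y\in\mathbb{R}^{\mathbb{N}^n_d}$,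 set $\langle f,y\rangle=\sum_\alpha f_\alpha y_\alpha$. $[x]_t$ is the column vector of all monomials in $x$ of degree at most $t$; for $\xi=(\xi_\alpha)\in\mathbb{R}^{\mathbb{N}^n_m}$, $\xi^T[x]_m=\sum_{|\alpha|\le m}\xi_\alpha x^\alpha$. For a polynomial $q$ and an integer $k$, put $t=k-\lceil \deg(q)/2\rceil$. If $t\ge 0$, expand $q(x)[x]_t[x]_t^T=\sum_{\alpha\in\mathbb{N}^n_{2k}}x^\alpha Q_\alpha$ with constant symmetric matrices $Q_\alpha$, and for $y\in\mathbb{R}^{\mathbb{N}^n_{2k}}$ define the $k$th localizing matrix $$L_q^{(k)}[y]=\sum_{\alpha\in\mathbb{N}^n_{2k}}y_\alpha Q_\alpha .$$ If $t<0$, a constraint involving $L_q^{(k)}[y]$ is vacuous. If $q$ is the zero polynomial, $L_q^{(k)}[y]=0$. The moment matrix is $M_k[y]=L_1^{(k)}[y]$. $X\succeq 0$ means the symmetric matrix $X$ is positive semidefinite. **Program $(P_k)$**, for $k\ge m_0$, with optimal value $v_k$: minimize $\langle \mathcal{A}(x),y\rangle$ over $y\in\mathbb{R}^{\mathbb{N}^n_{2k}}$ subject to $$L^{(k)}_{e^Tx-1}[y]=0,\quad L^{(k)}_{x_ip_i}[y]=0\ (i=1,\ldots,n),\quad L^{(k)}_{1-\|x\|^2}[y]\succeq 0,$$ $$L^{(k)}_{x_i}[y]\succeq 0,\quad L^{(k)}_{p_i}[y]\succeq 0\ (i=1,\ldots,n),\quad y_0=1,\quad M_k[y]\succeq 0.$$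 **Program $(Q_k)$**, for $k\ge m_0$ and a given $\xi\in\mathbb{R}^{\mathbb{N}^n_m}$: minimize $\langle \xi^T[x]_m,y\rangle$ over $y\in\mathbb{R}^{\mathbb{N}^n_{2k}}$ subject to $$L^{(k)}_{e^Tx-1}[y]=0,\quad L^{(k)}_{x_i}[y]\succeq 0\ (i=1,\ldots,n),\quad L^{(k)}_{1-\|x\|^2}[y]\succeq 0,$$ $$L^{(k)}_{v_k-\mathcal{A}(x)}[y]\succeq 0,\quad y_0=1,\quad M_k[y]\succeq 0,$$ where $v_k$ is the optimal value of $(P_k)$. **Algorithm** (input $\mathcal{A}$; all semidefinite programs are assumed to be solved exactly). - Step 0: Choose a vector $\xi\in\mathbb{R}^{\mathbb{N}^n_m}$. Let $k:=m_0$. - Step 1: Solve $(P_k)$. If $v_k\ge 0$, declare $\mathcal{A}$ copositive and stop. If $v_k<0$, go to Step 2. - Step 2: Solve $(Q_k)$ for an optimizer $\hat y$ (any optimizer) if it is feasible. If it is infeasible, let $k:=k+1$ and go to Step 1. - Step 3: Let $u=(\hat y_{e_1},\ldots,\hat y_{e_n})$. If $\mathcal{A}(u)<0$, declare $\mathcal{A}$ not copositive and stop; otherwise let $k:=k+1$ and go to Step 1. *)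

(* Defs.v *)
(* mpoly has to be imported before the mathcomp-analysis files: in the other
   order their notations are incompatible. *)
From mathcomp Require Import all_boot all_order all_algebra all_fingroup.
From mathcomp Require Import mpoly.
From mathcomp Require Import boolp classical_sets reals ereal topology normedtype.
From mathcomp Require Import sequences.

Set Implicit Arguments.
Unset Strict Implicit.
Unset Printing Implicit Defensive.

Import Order.TTheory GRing.Theory Num.Theory.

Local Open Scope classical_set_scope.
Local Open Scope ring_scope.

Section Optimization.
Variables (R : realType) (T : Type).
Implicit Types (S : set T) (f : T -> R).

Definition optimizer S f (z : T) : Prop :=
  S z /\ forall z', S z' -> f z <= f z'.

(* The real infimum is the mathematical one only if S is nonempty and f is
   bounded below on S (otherwise [inf] returns a default value); when an
   optimizer exists, it is the minimum. *)
Definition optval S f : R := inf (f @` S).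

End Optimization.

Section Tensors.
Variables (R : realType) (m n : nat).

Definition tensor : Type := {ffun m.-tuple 'I_n -> R}.

Definition symmetric_tensor (A : tensor) : Prop :=
  forall (s : 'S_m) (i : m.-tuple 'I_n), A [tuple tnth i (s j) | j < m] = A i.

Definition tform (A : tensor) : {mpoly R[n]} :=
  \sum_(i : m.-tuple 'I_n) A i *: \prod_(j < m) 'X_(tnth i j).

Definition copositive (A : tensor) : Prop :=
  forall x : 'I_n -> R, (forall i, 0 <= x i) -> 0 <= (tform A).@[x].

Definition simplex : set ('I_n -> R) :=
  [set x | \sum_i x i = 1 /\ forall i, 0 <= x i].

(* For n > 0 the simplex is nonempty and compact, so this is a minimum. *)
Definition vstar (A : tensor) : R := optval simplex (fun x => (tform A).@[x]).

Definition critpoly (A : tensor) (i : 'I_n) : {mpoly R[n]} :=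
  (tform A)^`M(i) - m%:R *: tform A.

End Tensors.

Definition psd (R : realType) (N : nat) (X : 'M[R]_N) : Prop :=
  X^T = X /\ forall v : 'cV[R]_N, 0 <= (v^T *m X *m v) 0 0.

Section Moments.
Variables (R : realType) (n : nat).

(* 'X_{1..n < d.+1} is the finite type of exponents alpha with |alpha| <= d. *)
Definition momvec (d : nat) : Type := 'X_{1..n < d.+1} -> R.

Definition pairing (d : nat) (f : {mpoly R[n]}) (y : momvec d) : R :=
  \sum_(a : 'X_{1..n < d.+1}) f@_a * y a.

Definition polyof (d : nat) (xi : momvec d) : {mpoly R[n]} :=
  \sum_(a : 'X_{1..n < d.+1}) xi a *: 'X_[a].

(* Degree, with the value 0 for the zero polynomial. *)
Definition degp (q : {mpoly R[n]}) : nat := (msize q).-1.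

(* ceil (deg q / 2); the localizing matrix of order k exists if this is at most
   k. *)
Definition halfdeg (q : {mpoly R[n]}) : nat := uphalf (degp q).

(* The column [x]_t; its rows are indexed through the enumeration of the
   monomials of degree at most t. *)
Definition monomials (t : nat) : 'cV[{mpoly R[n]}]_#|{: 'X_{1..n < t.+1}}| :=
  \col_i 'X_[bmnm (enum_val i)].

(* Meant for halfdeg q <= k only, since the subtraction is truncated. *)
Definition locmx (k : nat) (q : {mpoly R[n]}) (y : momvec k.*2) :
    'M[R]_#|{: 'X_{1..n < (k - halfdeg q).+1}}| :=
  let xt := monomials (k - halfdeg q) in
  \sum_(a : 'X_{1..n < k.*2.+1})
    y a *: map_mx (fun p : {mpoly R[n]} => p@_a) (q *: (xt *m xt^T)).

Definition loc_zero (k : nat) (q : {mpoly R[n]}) (y : momvec k.*2) : Prop :=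
  (halfdeg q <= k)%N -> locmx q y = 0.

Definition loc_psd (k : nat) (q : {mpoly R[n]}) (y : momvec k.*2) : Prop :=
  (halfdeg q <= k)%N -> psd (locmx q y).

Definition mommx (k : nat) (y : momvec k.*2) := locmx 1 y.

(* <x_i, y> is the entry of y at the unit exponent e_i (for k > 0). *)
Definition first_moments (k : nat) (y : momvec k.*2) : 'I_n -> R :=
  fun i => pairing 'X_i y.

Definition sumpoly : {mpoly R[n]} := \sum_(i < n) 'X_i - 1.

Definition ballpoly : {mpoly R[n]} := 1 - \sum_(i < n) 'X_i ^+ 2.

End Moments.

Section Programs.
Variables (R : realType) (m n : nat) (A : tensor R m n).

Definition feasP (k : nat) : set (momvec R n k.*2) :=
  [set y | loc_zero (sumpoly R n) y
        /\ (forall i, loc_zero ('X_i * critpoly A i) y)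
        /\ loc_psd (ballpoly R n) y
        /\ (forall i, loc_psd 'X_i y)
        /\ (forall i, loc_psd (critpoly A i) y)
        /\ y bm0 = 1
        /\ psd (mommx y)].

Arguments feasP : clear implicits.

Definition costP (k : nat) (y : momvec R n k.*2) : R := pairing (tform A) y.

(* The optimal value v_k. *)
Definition vmom (k : nat) : R := optval (feasP k) (@costP k).

Definition feasQ (k : nat) : set (momvec R n k.*2) :=
  [set y | loc_zero (sumpoly R n) y
        /\ (forall i, loc_psd 'X_i y)
        /\ loc_psd (ballpoly R n) y
        /\ loc_psd ((vmom k)%:MP - tform A) y
        /\ y bm0 = 1
        /\ psd (mommx y)].

Definition costQ (xi : momvec R n m) (k : nat) (y : momvec R n k.*2) : R :=
  pairing (polyof xi) y.

End Programs.

Arguments feasP {R m n} A k _.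
Arguments costP {R m n} A {k} y.
Arguments feasQ {R m n} A k _.
Arguments costQ {R m n} xi {k} y.

Section Algorithm.
Variables (R : realType) (m n : nat) (A : tensor R m n) (xi : momvec R n m).

Inductive state : Type :=
| Step1 of nat
| Step2 of nat
| Step3 (k : nat) of momvec R n k.*2
| DeclaredCopositive of nat
| DeclaredNotCopositive of nat & ('I_n -> R).

(* Nondeterministic: any optimizer of (Q_k) may be chosen in Step 2. *)
Definition step (s s' : state) : Prop :=
  match s with
  | Step1 k =>
      s' = if 0 <= vmom A k then DeclaredCopositive k else Step2 k
  | Step2 k =>
      (exists2 y, optimizer (feasQ A k) (costQ xi) y & s' = Step3 y)
      \/ (feasQ A k = set0 /\ s' = Step1 k.+1)
  | Step3 k y =>
      let u := first_moments y in
      s' = if (tform A).@[u] < 0 then DeclaredNotCopositive k u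
           else Step1 k.+1
  | DeclaredCopositive _ | DeclaredNotCopositive _ _ => False
  end.

(* Whatever choices are made, the execution started in the state s reaches in
   finitely many steps, without getting stuck before, a state that satisfies
   Q. *)
Inductive must_reach (Q : state -> Prop) (s : state) : Prop :=
| Reached of Q s
| Continue of (exists s', step s s')
           & (forall s', step s s' -> must_reach Q s').

Definition algorithm_must_end (Q : state -> Prop) : Prop :=
  must_reach Q (Step1 (uphalf m)).

End Algorithm.

Section LebesgueNull.
Variables (R : realType) (I : finType).

Definition box (a b : I -> R) : set (I -> R) :=
  [set x | forall i, a i <= x i <= b i].

Definition lebesgue_outer (S : set (I -> R)) : \bar R :=
  ereal_inf [set v | exists a b : nat -> I -> R,
    [/\ forall j i, a j i <= b j i,
        S `<=` \bigcup_j box (a j) (b j)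
      & v = (\sum_(0 <= j <oo) (\prod_i (b j i - a j i))%:E)%E]].

(* A set is null for the (complete) Lebesgue measure on R^I if and only if its
   Lebesgue outer measure is zero. *)
Definition almost_all (P : (I -> R) -> Prop) : Prop :=
  lebesgue_outer [set x | ~ P x] = 0%E.

End LebesgueNull.

(* Main.v *)
From HB Require Import structures.
Require Import Defs.
From mathcomp Require Import all_boot all_order all_algebra all_fingroup.
From mathcomp Require Import mpoly.
From mathcomp Require Import boolp classical_sets reals ereal topology normedtype.
From mathcomp Require Import sequences.
From mathcomp Require Import ring lra zify.

Set Implicit Arguments.
Unset Strict Implicit.
Unset Printing Implicit Defensive.

Import Order.TTheory GRing.Theory Num.Theory.
Import numFieldNormedType.Exports.

Local Open Scope classical_set_scope.
Local Open Scope ring_scope.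

(** Write [f] for the form of the tensor and [v] for its minimum over the
    simplex.  A moment vector of order [k] is read as a linear functional on
    polynomials that is nonnegative on the tested squares; evaluation at a point
    is the basic example, and the programs relax minimization over points to
    minimization over such functionals.

    Compactness.  The ball constraint bounds every moment by 1
    ([moment_bound]), so the feasible sets are compact and minima are attained.
    Compactness is used through one ultrafilter on [nat] along which all bounded
    real sequences converge ([ultralimit], [attain_min]).

    From functionals to points.  A functional that is nonnegative on all the
    constraints, a state, cannot beat the evaluations ([state_point]).  This
    stands in for Putinar's Positivstellensatz: a state that minimizes [f] can
    be reweighted by squares, so minimality forces it to give [f] a definite
    value; minimizing the coordinates one after the other then turns it into an
    evaluation at a point that satisfies the constraints.

    Finite convergence in (i).  The minimizers over the simplex satisfy the
    Karush-Kuhn-Tucker conditions ([minimizer_kkt]), so the first program is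
    feasible and [v_k <= v].  For the converse, the decisive fact is algebraic:
    some nonzero univariate [G] has [G(f)] in the ideal generated by
    [sum x_i - 1] and the [x_i p_i] ([kkt_values_algebraic]).  Otherwise a
    residue field of the polynomial ring modulo this ideal would contain [f] as
    a transcendental element and hence carry a derivation [D] with [D f = 1],
    while the chain rule along [x_i p_i = 0] and [sum x_i = 1] gives [D f = 0].
    Now factor [G = H * ('X - v)^N] with [H(v) != 0].  The part of a feasible
    functional where [f - v] is nilpotent contributes exactly 0 to [f - v].  If
    the other part contributed a negative amount for infinitely many orders,
    the reweighted functionals would accumulate at a state with [H(f) = 0] and
    [f <= v], hence at a point of the simplex with [f <= v] and [f <> v], which
    does not exist ([asymptotic_lower_bound]).

    The algorithm.  If [f] is copositive then [v >= 0], the first test succeeds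
    as soon as [v_k = v], and the second test cannot succeed because the first
    moments lie in the simplex.  If [f] is not copositive then [v_k <= v < 0],
    so only the second test can stop the algorithm.  For large [k] the second
    program relaxes the minimization of [xi] over the minimizers of [f]; when
    the minimizer is unique, the states of minimal cost have its coordinates as
    first moments, so the first moments converge to it and [f] becomes negative
    there ([optimizers_eventually_negative]).  Uniqueness holds for almost every
    [xi]: the exceptional parameters form countably many partial Lipschitz
    graphs, because minimizers depend monotonically on the cost
    ([almost_all_unique_minimizer]). *)

(** * Extension of derivations *)

(** Zorn's lemma above a given element; chains are nonempty here, which suits
    structures that have to contain a prescribed part. *)
Lemma Zorn_above (T : Type) (P : set (set T)) (X0 : set T) :
    P X0 ->
    (forall F : set (set T), F !=set0 -> F `<=` P -> total_on F subset ->
      P (\bigcup_(X in F) X)) ->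
  exists A, [/\ X0 `<=` A, P A & forall B, A `<=` B -> P B -> B = A].
Proof.
move=> P0 Pchain.
have [F FP Ftot|A [PA Amax]] := @Zorn_bigcup T (fun A => P (A `|` X0)).
  have [->|F0] := eqVneq F set0; first by rewrite bigcup_set0 set0U.
  have -> : (\bigcup_(X in F) X) `|` X0
          = \bigcup_(Y in [set X `|` X0 | X in F]) Y.
    apply/seteqP; split=> x /=.
      case=> [[X FX Xx]|X0x]; first by exists (X `|` X0); [exists X|left].
      have /set0P[X FX] := F0.
      by exists (X `|` X0); [exists X|right].
    by case=> _ [X FX <-] [Xx|X0x]; [left; exists X|right].
  apply: Pchain => [|_ [X FX <-]|_ _ [X FX <-] [Y FY <-]].
  - have /set0P[X FX] := F0; by exists (X `|` X0); exists X.
  - exact: FP.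
  - by case: (Ftot _ _ FX FY) => s; [left|right]; apply: setSU.
exists (A `|` X0); split=> // B sAB PB; apply/seteqP; split=> //.
apply: contrapT => nBA; apply: (Amax B).
  by rewrite properEneq; split; [apply/eqP => AB; apply: nBA; rewrite -AB|];
    move=> x Ax; [left|apply: sAB; left].
by rewrite setUidl // => x X0x; apply: sAB; right.
Qed.

Section DerivationExtension.
Variables (F : fieldType) (k : set F) (t : F).
Hypothesis F_char0 : [pchar F] =i pred0.
Hypothesis k1 : k 1.
Hypothesis kB : forall a b, k a -> k b -> k (a - b).
Hypothesis kM : forall a b, k a -> k b -> k (a * b).
Hypothesis t_transcendental :
  forall p : {poly F}, (forall i, k p`_i) -> root p t -> p = 0.

(** The graph of a derivation defined on a subring: equivalently, a subring of
    the dual numbers [F[eps]] that meets the ideal of [eps] trivially.  Graphs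
    are ordered by inclusion, which suits Zorn's lemma. *)
Definition derivation_graph (G : set (F * F)) : Prop :=
  [/\ G (1, 0),
      forall x y, G x -> G y -> G (x.1 - y.1, x.2 - y.2),
      forall x y, G x -> G y -> G (x.1 * y.1, x.1 * y.2 + x.2 * y.1)
    & forall b, G (0, b) -> b = 0].

Section Graph.
Variable G : set (F * F).
Hypothesis hG : derivation_graph G.

Lemma graph1 : G (1, 0). Proof. by case: hG. Qed.

Lemma graphB a a' b b' : G (a, a') -> G (b, b') -> G (a - b, a' - b').
Proof. by case: hG => _ h _ _; exact: (h (a, a') (b, b')). Qed.

Lemma graphM a a' b b' :
  G (a, a') -> G (b, b') -> G (a * b, a * b' + a' * b).
Proof. by case: hG => _ _ h _; exact: (h (a, a') (b, b')). Qed.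

Lemma graph_fun b : G (0, b) -> b = 0. Proof. by case: hG => _ _ _; apply. Qed.

Lemma graph0 : G (0, 0).
Proof. by have := graphB graph1 graph1; rewrite !subrr. Qed.

Lemma graphN a a' : G (a, a') -> G (- a, - a').
Proof. by move=> /(graphB graph0); rewrite !sub0r. Qed.

Lemma graphD a a' b b' : G (a, a') -> G (b, b') -> G (a + b, a' + b').
Proof. by move=> Ga /graphN Gb; have := graphB Ga Gb; rewrite !opprK. Qed.

Lemma graphMn a a' n : G (a, a') -> G (a *+ n, a' *+ n).
Proof.
move=> Ga; elim: n => [|n IH]; first exact: graph0.
by rewrite !mulrS; apply: graphD.
Qed.

Lemma graph_sum (I : Type) (r : seq I) (f f' : I -> F) :
  (forall i, G (f i, f' i)) -> G (\sum_(i <- r) f i, \sum_(i <- r) f' i).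
Proof.
move=> Gf; elim: r => [|i r IH]; first by rewrite !big_nil; apply: graph0.
by rewrite !big_cons; apply: graphD.
Qed.

Lemma graph_unique a b b' : G (a, b) -> G (a, b') -> b = b'.
Proof.
move=> Gb Gb'; apply/eqP; rewrite -subr_eq0; apply/eqP/graph_fun.
by have := graphB Gb Gb'; rewrite subrr.
Qed.

End Graph.

(** Polynomials over the dual numbers whose coefficients lie in [G]. *)
Definition graph_poly (G : set (F * F)) (p q : {poly F}) : Prop :=
  forall i, G (p`_i, q`_i).

(** The fractions of [G]: the dual numbers that some element of [G] with nonzero
    first component multiplies into [G].  This is the quotient rule. *)
Definition localized_graph (G : set (F * F)) : set (F * F) :=
  [set x | exists s s', [/\ G (s, s'), s != 0
    & G (s * x.1, s * x.2 + s' * x.1)]].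

Lemma derivation_graph_localized G :
  derivation_graph G -> derivation_graph (localized_graph G).
Proof.
move=> hG; have G1 := graph1 hG; split.
- by exists 1, 0; split=> //=; rewrite ?oner_eq0 // mul0r mulr0 addr0 mul1r.
- move=> [a a'] [b b'] [s [s' [Gs s0 Gsa]]] [u [u' [Gu u0 Gub]]] /=.
  exists (s * u), (s * u' + s' * u); split=> /=.
  + exact: graphM.
  + by rewrite mulf_neq0.
  have := graphB hG (graphM hG Gsa Gu) (graphM hG Gub Gs) => /=.
  by congr (G (_, _)); rewrite /=; ring.
- move=> [a a'] [b b'] [s [s' [Gs s0 Gsa]]] [u [u' [Gu u0 Gub]]] /=.
  exists (s * u), (s * u' + s' * u); split=> /=.
  + exact: graphM.
  + by rewrite mulf_neq0.
  have := graphM hG Gsa Gub => /=.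
  by congr (G (_, _)); rewrite /=; ring.
- move=> b [s [s' [Gs s0 /=]]]; rewrite !mulr0 addr0 => /(graph_fun hG) /eqP.
  by rewrite mulf_eq0 (negPf s0) => /eqP.
Qed.

Lemma sub_localized_graph G : derivation_graph G -> G `<=` localized_graph G.
Proof.
move=> hG [a a'] Ga; exists 1, 0; split=> //=; first exact: graph1.
  by rewrite oner_eq0.
by rewrite mul0r addr0 !mul1r.
Qed.

(** The subring generated by [G] and [a + b eps]: the value of [p + q eps] at
    that point has second component [q(a) + p'(a) b]. *)
Definition adjoined_graph (G : set (F * F)) (a b : F) : set (F * F) :=
  [set x | exists p q, graph_poly G p q
    /\ x = (p.[a], q.[a] + p^`().[a] * b)].

Lemma derivation_graph_adjoined G a b : derivation_graph G ->
  (forall p q, graph_poly G p q -> root p a -> q.[a] + p^`().[a] * b = 0) ->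
  derivation_graph (adjoined_graph G a b).
Proof.
move=> hG hb; split.
- exists 1, 0; split; last by rewrite hornerC horner0 derivC horner0 mul0r addr0.
  move=> i; rewrite coef1 coef0; case: (i == 0%N); first exact: graph1.
  exact: graph0.
- move=> _ _ [p [q [pq ->]]] [r [s [rs ->]]] /=.
  exists (p - r), (q - s); split=> [i|].
    by rewrite !coefB; apply: graphB.
  by rewrite derivB !hornerD !hornerN; congr (_, _); ring.
- move=> _ _ [p [q [pq ->]]] [r [s [rs ->]]] /=.
  exists (p * r), (p * s + q * r); split=> [i|].
    rewrite coefD !coefM -big_split /=; apply: graph_sum => // j.
    exact: graphM.
  by rewrite derivM !hornerD !hornerM; congr (_, _); ring.
- move=> c [p [q [pq [pa0 ->]]]]; apply: hb => //; exact/eqP/esym.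
Qed.

Lemma sub_adjoined_graph G a b :
  derivation_graph G -> G `<=` adjoined_graph G a b.
Proof.
move=> hG [c c'] Gc; exists c%:P, c'%:P; split.
  by move=> i; rewrite !coefC; case: eqP => // _; apply: graph0.
by rewrite !hornerC derivC horner0 mul0r addr0.
Qed.

Lemma mem_adjoined_graph G a b : derivation_graph G -> adjoined_graph G a b (a, b).
Proof.
move=> hG; exists 'X, 0; split.
  move=> i; rewrite coefX coef0; case: (i == 1%N); first exact: graph1.
  exact: graph0.
by rewrite hornerX derivX horner0 hornerC mul1r add0r.
Qed.

(** A derivation extends to a larger element [a] of a field of characteristic
    0: its value at [a] is free when [a] is transcendental, and is forced by
    the minimal polynomial, which is separable, when [a] is algebraic. *)
Lemma adjoin_value G a : derivation_graph G ->
    (forall c c', G (c, c') -> c != 0 -> exists d, G (c^-1, d)) ->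
  exists b, forall p q, graph_poly G p q -> root p a ->
    q.[a] + p^`().[a] * b = 0.
Proof.
move=> hG Ginv.
pose ann (s : nat) := `[< exists p q,
  [/\ graph_poly G p q, root p a, p != 0 & size p = s] >].
have [[s anns]|nann] := pselect (exists s, ann s); last first.
  exists 0 => p q pq pa.
  have [p0|p0] := eqVneq p 0; last first.
    by case: nann; exists (size p); apply/asboolP; exists p, q.
  suff -> : q = 0 by rewrite p0 deriv0 !horner0 mul0r addr0.
  apply/polyP => i; rewrite coef0; apply: (graph_fun hG).
  by have := pq i; rewrite p0 coef0.
have [s0 /asboolP[p0 [q0 [pq0 p0a p0N0 sp0]]] s0min] :=
  ex_minnP (ex_intro ann s anns).
have minp p q : graph_poly G p q -> root p a -> (size p < size p0)%N -> p = 0.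
  move=> pq pa lt; apply/eqP/negPn/negP => pN0.
  have : ann (size p) by apply/asboolP; exists p, q.
  by move=> /s0min; rewrite -sp0 leqNgt lt.
have sz0 : (1 < size p0)%N by apply: root_size_gt1 p0a.
(* The minimal polynomial is separable in characteristic 0. *)
have dp0 : p0^`().[a] != 0.
  apply/negP => dp0a.
  have : p0^`() = 0.
    apply: (minp _ q0^`()) => //; last exact: lt_size_deriv.
    by move=> i; rewrite !coef_deriv; apply: graphMn.
  move=> /(congr1 (fun p : {poly F} => p`_(size p0).-2)).
  rewrite coef_deriv coef0 -mulr_natr => /eqP.
  have -> : (size p0).-2.+1 = (size p0).-1 by case: (size p0) sz0 => [|[]].
  rewrite mulf_eq0 -/(lead_coef p0) lead_coef_eq0 (negPf p0N0) /=.
  move/(pcharf0P _): F_char0 => ->.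
  by case: (size p0) sz0 => [|[]].
exists (- q0.[a] / p0^`().[a]); set b := - _ / _.
have b0 : q0.[a] + p0^`().[a] * b = 0.
  by rewrite /b mulrCA divff // mulr1 addrN.
move=> p q; have [n] := ubnP (size p); elim: n p q => // n IH p q.
rewrite ltnS => szn pq pa.
have [lt|le] := ltnP (size p) (size p0).
  have p00 := minp _ _ pq pa lt.
  suff -> : q = 0 by rewrite p00 deriv0 !horner0 mul0r addr0.
  apply/polyP => i; rewrite coef0; apply: (graph_fun hG).
  by have := pq i; rewrite p00 coef0.
(* One step of the division of [p] by [p0], lifted to the dual numbers. *)
have [d Gd] : exists d, G ((lead_coef p0)^-1, d).
  apply: (Ginv _ (q0`_(size p0).-1)); first exact: pq0.
  by rewrite lead_coef_eq0.
have := graphM hG (pq (size p).-1) Gd; rewrite -/(lead_coef p).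
set c := _ / _; set c' := (X in G (_, X)) => Gc.
set j := (size p - size p0)%N.
pose p1 := p - c *: 'X^j * p0.
pose q1 := q - (c' *: 'X^j * p0 + c *: 'X^j * q0).
have pq1 : graph_poly G p1 q1.
  move=> i; rewrite /p1 /q1 2!coefB; apply: (graphB hG) => //.
  rewrite coefD -!scalerAl !coefZ !coefXnM; case: ifP => _.
    by rewrite !mulr0 addr0; apply: graph0.
  by rewrite addrC; apply: (graphM hG).
have p1a : root p1 a.
  by rewrite /p1 rootE hornerD hornerN hornerM (eqP p0a) mulr0 subr0 (eqP pa).
have pN0 : p != 0.
  by rewrite -size_poly_eq0 -lt0n (leq_trans _ le) // (ltn_trans _ sz0).
have sz1 : (size p1 < n)%N.
  have [->|p1N0] := eqVneq p1 0.
    by rewrite size_poly0 (leq_trans _ szn) // size_poly_gt0.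
  apply: (leq_trans _ szn).
  have cN0 : c != 0 by rewrite mulf_neq0 ?invr_eq0 ?lead_coef_eq0.
  have szr : size (c *: 'X^j * p0) = size p.
    rewrite -scalerAl size_scale // mulrC size_mulXn // subnK //.
  have lcr : lead_coef (c *: 'X^j * p0) = lead_coef p.
    rewrite lead_coefM lead_coefZ lead_coefXn mulr1 /c mulfVK //.
    by rewrite lead_coef_eq0.
  have szle : (size p1 <= size p)%N.
    by rewrite (leq_trans (size_polyD _ _)) // size_polyN szr maxnn.
  rewrite ltn_neqAle szle andbT; apply/eqP => sE.
  have : lead_coef p1 = 0.
    rewrite lead_coefE sE /p1 coefB -lead_coefE -szr -[X in _ - X]lead_coefE.
    by rewrite lcr subrr.
  by move/eqP; rewrite lead_coef_eq0 (negPf p1N0).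
rewrite -[RHS](IH _ _ sz1 pq1 p1a).
have pE : p = p1 + c *: 'X^j * p0 by rewrite subrK.
have qE : q = q1 + (c' *: 'X^j * p0 + c *: 'X^j * q0) by rewrite subrK.
rewrite pE qE; clearbody p1 q1.
rewrite derivD derivM !(hornerD, hornerM, hornerZ) (eqP p0a).
transitivity (q1.[a] + p1^`().[a] * b
    + c * 'X^j.[a] * (q0.[a] + p0^`().[a] * b)).
  by ring.
by rewrite b0 mulr0 addr0.
Qed.

(** The derivation ['d / 'd t] on [k[t]]. *)
Definition base_graph : set (F * F) :=
  [set x | exists2 p : {poly F}, (forall i, k p`_i) & x = (p.[t], p^`().[t])].

Lemma derivation_graph_base : derivation_graph base_graph.
Proof.
have k0 : k 0 by rewrite -(subrr 1); apply: kB.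
have kN a : k a -> k (- a) by rewrite -sub0r; apply: kB.
have kD a b : k a -> k b -> k (a + b).
  by move=> ka kb; rewrite -[b]opprK; apply: kB => //; apply: kN.
split.
- exists 1; last by rewrite hornerC derivC horner0.
  by move=> i; rewrite coef1; case: (i == 0%N).
- move=> _ _ [p kp ->] [q kq ->] /=; exists (p - q) => [i|].
    by rewrite coefB; apply: kB.
  by rewrite derivB !hornerD !hornerN.
- move=> _ _ [p kp ->] [q kq ->] /=; exists (p * q) => [i|].
    by rewrite coefM; apply: (big_ind k) => // j _; apply: kM.
  by rewrite derivM hornerD !hornerM addrC.
- move=> b [p kp [pt0 ->]].
  by rewrite (t_transcendental kp) ?deriv0 ?horner0 // rootE -pt0.
Qed.

(** Zorn's lemma gives a maximal derivation that extends ['d / 'd t]; its domain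
    is a field, by localization, and then everything, by adjunction. *)
Lemma derivation_exists : exists D : F -> F,
  [/\ forall a b, D (a + b) = D a + D b,
      forall a b, D (a * b) = a * D b + D a * b,
      forall c, k c -> D c = 0
    & D t = 1].
Proof.
have k0 : k 0 by rewrite -(subrr 1); apply: kB.
have [//|G [sG hG Gmax]] := Zorn_above derivation_graph_base.
  move=> A [X0 AX0] Ader Atot; split=> [|x y [X AX Xx] [Y AY Yy]
      |x y [X AX Xx] [Y AY Yy]|b [X AX]].
  - by exists X0 => //; apply: graph1; apply: Ader.
  - have [XY|YX] := Atot _ _ AX AY.
      by exists Y => //; have [_ h _ _] := Ader _ AY; apply: h => //; apply: XY.
    by exists X => //; have [_ h _ _] := Ader _ AX; apply: h => //; apply: YX.
  - have [XY|YX] := Atot _ _ AX AY.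
      by exists Y => //; have [_ _ h _] := Ader _ AY; apply: h => //; apply: XY.
    by exists X => //; have [_ _ h _] := Ader _ AX; apply: h => //; apply: YX.
  - by apply: graph_fun; apply: Ader.
have Glocal := Gmax _ (sub_localized_graph hG) (derivation_graph_localized hG).
have Ginv c c' : G (c, c') -> c != 0 -> exists d, G (c^-1, d).
  move=> Gc c0; exists (- c' * c^-1 * c^-1); rewrite -Glocal.
  exists c, c'; split=> //=; rewrite mulfV // !mulNr mulrN -mulrA [c * _]mulrC.
  rewrite -!mulrA mulVf // mulr1 addNr; exact: graph1.
have Gtot a : exists b, G (a, b).
  have [b hb] := adjoin_value a hG Ginv.
  exists b; rewrite -(Gmax _ (sub_adjoined_graph a b hG)).
    exact: mem_adjoined_graph.
  exact: derivation_graph_adjoined.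
have [D GD] := choice Gtot; exists D; split.
- move=> a b; apply: (graph_unique hG (GD _)); exact: graphD.
- move=> a b; apply: (graph_unique hG (GD _)); exact: graphM.
- move=> c kc; apply: (graph_unique hG (GD _)); apply: sG.
  exists c%:P; last by rewrite hornerC derivC horner0.
  by move=> i; rewrite coefC; case: (i == 0%N).
- apply: (graph_unique hG (GD _)); apply: sG; exists 'X.
    by move=> i; rewrite coefX; case: (i == 1%N).
  by rewrite hornerX derivX hornerC.
Qed.

End DerivationExtension.

(** * Residue fields *)

Definition is_ideal (B : comNzRingType) (J : set B) : Prop :=
  [/\ J 0, forall a b, J a -> J b -> J (a + b) & forall a b, J b -> J (a * b)].

Section PrimeQuotient.
Variables (B : comNzRingType) (J : set B).
Hypothesis J_ideal : is_ideal J.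
Hypothesis J_proper : ~ J 1.
Hypothesis J_prime : forall u v, J (u * v) -> J u \/ J v.

(** The hypotheses are arguments so that the structure of prime ideal can be
    attached to the predicate. *)
Definition prime_pred
  of is_ideal J & ~ J 1 & (forall u v, J (u * v) -> J u \/ J v) : {pred B} :=
  fun x => `[< J x >].

Local Notation P := (prime_pred J_ideal J_proper J_prime).

Fact prime_pred_idealr : idealr_closed P.
Proof.
case: J_ideal => J0 JD JM; split; first exact/asboolP.
  by apply/negP => /asboolP.
move=> a u v /asboolP Ju /asboolP Jv; apply/asboolP; apply: JD => //.
exact: JM.
Qed.

HB.instance Definition _ := isIdealr.Build B P prime_pred_idealr.

Fact prime_pred_prime : prime_idealr_closed P.
Proof.
move=> u v /asboolP /J_prime[Ju|Jv]; apply/orP; [left|right]; exact/asboolP.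
Qed.

HB.instance Definition _ := isPrimeIdealrClosed.Build B P prime_pred_prime.

Definition prime_quot : Type := {ideal_quot P}.

HB.instance Definition _ := GRing.ComNzRing.on prime_quot.

Let qunit : pred prime_quot := fun x => `[< exists y, y * x = 1 >].
Let qinv (x : prime_quot) : prime_quot :=
  if pselect (exists y, y * x = 1) is left ex then projT1 (cid ex) else x.

Fact prime_quot_mulVx : {in qunit, left_inverse 1 qinv *%R}.
Proof.
move=> x /asboolP ex; rewrite /qinv; case: pselect => // e.
by case: (cid e).
Qed.

Fact prime_quot_unitPl (x y : prime_quot) : y * x = 1 -> qunit x.
Proof. by move=> yx; apply/asboolP; exists y. Qed.

Fact prime_quot_invr_out : {in [predC qunit], qinv =1 id}.
Proof.
move=> x /asboolP nex; rewrite /qinv; case: pselect => // e.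
Qed.

HB.instance Definition _ := GRing.ComNzRing_hasMulInverse.Build prime_quot
  prime_quot_mulVx prime_quot_unitPl prime_quot_invr_out.

Fact prime_quot_mulf_eq0 (x y : prime_quot) :
  x * y = 0 -> (x == 0) || (y == 0).
Proof. exact: (@Quotient.rquot_IdomainAxiom B P). Qed.

HB.instance Definition _ :=
  GRing.ComUnitRing_isIntegral.Build prime_quot prime_quot_mulf_eq0.

Lemma prime_residue_field : exists (F : fieldType) (phi : {rmorphism B -> F}),
  forall a, phi a = 0 <-> J a.
Proof.
pose pi : {rmorphism B -> prime_quot} := \pi_({ideal_quot P})%qT.
exists {fraction prime_quot}.
exists ((@FracField.tofrac prime_quot : {rmorphism _ -> _}) \o pi).
move=> a /=; split.
  move/eqP; rewrite tofrac_eq0 => /eqP pia.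
  have pi0 : pi 0 = 0 by rewrite rmorph0.
  have /eqP : pi a = pi 0 by rewrite pi0; exact: pia.
  by rewrite -Quotient.idealrBE subr0 => /asboolP.
move=> Ja; apply/eqP; rewrite tofrac_eq0; apply/eqP.
suff E : pi a = pi 0 by rewrite -[RHS](rmorph0 pi); exact: E.
by apply/eqP; rewrite -Quotient.idealrBE subr0; apply/asboolP.
Qed.

End PrimeQuotient.

(** Ideals that are maximal among those avoiding a multiplicative set are prime;
    the field of fractions of the quotient is the required field. *)
Lemma residue_field_avoiding (B : comNzRingType) (I S : set B) :
    is_ideal I -> S 1 -> (forall a b, S a -> S b -> S (a * b)) ->
    (forall a, I a -> ~ S a) ->
  exists (F : fieldType) (phi : {rmorphism B -> F}),
    (forall a, I a -> phi a = 0) /\ (forall a, S a -> phi a != 0).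
Proof.
move=> I_ideal S1 SM IS.
have [//|Fm Fm0 Fmok Ftot|J [IJ [J_ideal JS] Jmax]] :=
  @Zorn_above B (fun J => is_ideal J /\ forall a, J a -> ~ S a) I.
  have [X0 FX0] := Fm0; split; last first.
    by move=> a [X FX Xa]; apply: (Fmok _ FX).2.
  split.
  - by exists X0 => //; have [[]] := Fmok _ FX0.
  - move=> a b [X FX Xa] [Y FY Yb].
    have [XY|YX] := Ftot _ _ FX FY.
      by exists Y => //; have [[_ h _] _] := Fmok _ FY; apply: h => //; apply: XY.
    by exists X => //; have [[_ h _] _] := Fmok _ FX; apply: h => //; apply: YX.
  - move=> a b [X FX Xb]; exists X => //.
    by have [[_ _ h] _] := Fmok _ FX; apply: h.
have [J0 JD JM] := J_ideal.
have J1 : ~ J 1 by move=> /JS.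
have meet u : ~ J u -> exists j a, J j /\ S (j + a * u).
  move=> nJu; pose J' := [set x | exists j a, J j /\ x = j + a * u].
  apply: contrapT => nS; apply: nJu.
  have JJ' : J `<=` J' by move=> j Jj; exists j, 0; rewrite mul0r addr0.
  rewrite -(Jmax J' JJ'); first by exists 0, 1; rewrite mul1r add0r.
  split; last by move=> _ [j [a [Jj ->]]] Sja; apply: nS; exists j, a.
  split; first exact: JJ'.
    move=> _ _ [j [a [Jj ->]]] [j' [a' [Jj' ->]]].
    by exists (j + j'), (a + a'); split; [exact: JD|ring].
  move=> c _ [j [a [Jj ->]]]; exists (c * j), (c * a); split; first exact: JM.
  by ring.
have J_prime u v : J (u * v) -> J u \/ J v.
  move=> Juv; apply: contrapT => /not_orP[/meet[j [a [Jj Su]]]].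
  move=> /meet[j' [a' [Jj' Sv]]]; apply: (JS _ _ (SM _ _ Su Sv)).
  have -> : (j + a * u) * (j' + a' * v)
     = (j' + a' * v) * j + (a * u * j' + a * a' * (u * v)) by ring.
  by apply: (JD); [exact: JM|apply: JD; exact: JM].
have [F [phi phiJ]] := prime_residue_field J_ideal J1 J_prime.
exists F, phi; split=> a; first by move=> /IJ /phiJ.
by move=> Sa; apply/eqP => /phiJ /JS.
Qed.

(** * Critical values are algebraic *)

Lemma mpoly_ring_ind (n : nat) (R : comNzRingType) (P : {mpoly R[n]} -> Prop) :
    (forall c, P c%:MP) -> (forall i, P 'X_i) ->
    (forall p q, P p -> P q -> P (p + q)) ->
    (forall p q, P p -> P q -> P (p * q)) ->
  forall p, P p.
Proof.
move=> PC PX PD PM p.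
have PXm m : P 'X_[m].
  have P1 : P 1 by rewrite -mpolyC1.
  rewrite mpolyXE_id; apply: (big_ind P) => // i _.
  by elim: (m i) => // k IH; rewrite exprS; apply: PM.
elim/mpolyind: p => [|c m p _ _ Pp]; first by rewrite -mpolyC0.
by apply: PD => //; rewrite -mul_mpolyC; apply: PM.
Qed.

Lemma mderivXU (n : nat) (R : comNzRingType) (i j : 'I_n) :
  ('X_j)^`M(i) = (i == j)%:R :> {mpoly R[n]}.
Proof.
rewrite mderivX mnm1E eq_sym; case: eqP => [->|_]; last by rewrite scale0r.
have -> : (U_(j) - U_(j))%MM = 0%MM by apply/mnmP => l; rewrite mnmBE subnn mnm0E.
by rewrite mpolyX0 scale1r.
Qed.

Section AlgebraicValues.
Variables (R : fieldType) (n : nat).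
Hypothesis R_char0 : [pchar R] =i pred0.
Implicit Types (f g q : {mpoly R[n]}).

Definition poly_at f (G : {poly R}) : {mpoly R[n]} :=
  (map_poly (@mpolyC n R) G).[f].

(** The ideal of [sum x_i - 1] and the [x_i ('d f / 'd x_i - g)].  With [g] the
    multiple [m f] of a form of degree [m], these are the equations of the
    points that satisfy the Karush-Kuhn-Tucker conditions on the simplex. *)
Definition kkt_ideal f g : set {mpoly R[n]} :=
  [set q | exists (c0 : {mpoly R[n]}) (c : 'I_n -> {mpoly R[n]}),
    q = c0 * (\sum_(i < n) 'X_i - 1)
        + \sum_(i < n) c i * ('X_i * (f^`M(i) - g))].

Lemma kkt_ideal_ideal f g : is_ideal (kkt_ideal f g).
Proof.
split.
- exists 0, (fun _ => 0); rewrite mul0r add0r big1 // => i _; by rewrite mul0r.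
- move=> _ _ [c0 [c ->]] [d0 [d ->]]; exists (c0 + d0), (fun i => c i + d i).
  rewrite mulrDl addrACA -big_split; congr (_ + _).
  by apply: eq_bigr => i _; rewrite mulrDl.
- move=> a _ [c0 [c ->]]; exists (a * c0), (fun i => a * c i).
  rewrite mulrDr mulrA mulr_sumr; congr (_ + _).
  by apply: eq_bigr => i _; exact: mulrA.
Qed.

Lemma derivation_chain_rule (F : fieldType) (phi : {rmorphism {mpoly R[n]} -> F})
    (D : F -> F) :
    (forall a b, D (a + b) = D a + D b) ->
    (forall a b, D (a * b) = a * D b + D a * b) ->
    (forall c : R, D (phi c%:MP) = 0) ->
  forall q, D (phi q) = \sum_(i < n) phi q^`M(i) * D (phi 'X_i).
Proof.
move=> DD DM DC; elim/mpoly_ring_ind => [c|j|p q IHp IHq|p q IHp IHq].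
- by rewrite DC big1 // => i _; rewrite mderivC rmorph0 mul0r.
- rewrite (bigD1 j) //= big1 => [|i /negPf ij].
    by rewrite mderivXU eqxx rmorph1 mul1r addr0.
  by rewrite mderivXU ij rmorph0 mul0r.
- rewrite rmorphD DD IHp IHq -big_split; apply: eq_bigr => i _ /=.
  by rewrite mderivD rmorphD mulrDl.
- rewrite rmorphM DM IHp IHq mulr_sumr mulr_suml -big_split.
  apply: eq_bigr => i _ /=.
  by rewrite mderivM rmorphD !rmorphM; ring.
Qed.

(** The critical values of a polynomial [f] are algebraic: they are the roots
    of one nonzero polynomial [G], even ideal-theoretically.  Otherwise there
    would be a point over a field [F] at which [f] is transcendental over the
    scalars, hence a derivation [D] of [F] with [D f = 1]; but wherever
    [x_i * ('d f / 'd x_i - g) = 0] and [sum x_i = 1], the chain rule gives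
    [D f = g * D (sum x_i) = 0]. *)
Lemma kkt_values_algebraic f g :
  exists2 G : {poly R}, G != 0 & kkt_ideal f g (poly_at f G).
Proof.
apply: contrapT => noG.
pose S : set {mpoly R[n]} := [set q | exists2 G, G != 0 & q = poly_at f G].
have [|||F [phi [phiI phiS]]] :=
    residue_field_avoiding (S := S) (kkt_ideal_ideal f g).
- exists 1; rewrite ?oner_eq0 // /poly_at rmorph1 hornerC //.
- move=> _ _ [G G0 ->] [H H0 ->]; exists (G * H); first by rewrite mulf_neq0.
  by rewrite /poly_at rmorphM hornerM.
- by move=> a Ia [G G0 aE]; apply: noG; exists G; rewrite // -aE.
pose psi : {rmorphism R -> F} := phi \o @mpolyC n R.
pose k : set F := range psi.
have F_char0 : [pchar F] =i pred0.
  by move=> j; rewrite (fmorph_pchar psi) R_char0.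
have phi_at G : phi (poly_at f G) = (map_poly psi G).[phi f].
  by rewrite /poly_at -horner_map -map_poly_comp.
have k_transcendental (p : {poly F}) :
    (forall i, k p`_i) -> root p (phi f) -> p = 0.
  move=> kp pf0; have /choice[c cE] i : exists c, psi c = p`_i.
    by case: (kp i) => c _ <-; exists c.
  pose G := \poly_(i < size p) c i.
  have pE : p = map_poly psi G.
    apply/polyP => i; rewrite coef_map coef_poly /=.
    have [lt|ge] := ltnP i (size p); first by rewrite -cE.
    by rewrite nth_default // rmorph0.
  have [G0|G0] := eqVneq G 0; first by rewrite pE G0 rmorph0.
  have : phi (poly_at f G) != 0 by apply: phiS; exists G.
  by rewrite phi_at -pE (eqP pf0) eqxx.
have [|||D [DD DM Dk Df]] :=
    derivation_exists (k := k) (t := phi f) F_char0 _ _ _ k_transcendental.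
- by exists 1; rewrite ?rmorph1.
- by move=> _ _ [a _ <-] [b _ <-]; exists (a - b); rewrite ?rmorphB.
- by move=> _ _ [a _ <-] [b _ <-]; exists (a * b); rewrite ?rmorphM.
have Dchain := derivation_chain_rule DD DM (fun c => Dk _ (imageT psi c)).
have sumX : phi (\sum_(i < n) 'X_i - 1) = 0.
  apply: phiI; exists 1, (fun=> 0).
  rewrite mul1r [X in _ = _ + X]big1 ?addr0 // => i _.
  by rewrite mul0r.
have kkt i : phi ('X_i * (f^`M(i) - g)) = 0.
  apply: phiI; exists 0, (fun j => (j == i)%:R); rewrite mul0r add0r.
  by rewrite (bigD1 i) //= big1 => [|j /negPf->];
    rewrite ?eqxx ?mul1r ?addr0 ?mul0r.
have D0 : D 0 = 0 by apply: (addIr (D 0)); rewrite -DD !add0r.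
have DsumX : \sum_(i < n) D (phi 'X_i) = 0.
  have D_sum (r : seq 'I_n) (h : 'I_n -> F) :
      D (\sum_(i <- r) h i) = \sum_(i <- r) D (h i).
    by elim: r => [|i r IH]; rewrite ?big_nil // !big_cons DD IH.
  move/eqP: sumX; rewrite rmorphB rmorph_sum rmorph1 subr_eq0 => /eqP sumX.
  by rewrite -D_sum sumX Dk //; exists 1; rewrite ?rmorph1.
have : D (phi f) = phi g * \sum_(i < n) D (phi 'X_i).
  rewrite Dchain mulr_sumr; apply: eq_bigr => i _.
  have /eqP := kkt i; rewrite rmorphM rmorphB mulf_eq0 subr_eq0.
  by case/orP => /eqP ->; rewrite ?D0 ?mulr0.
by rewrite Df DsumX mulr0 => /eqP; rewrite oner_eq0.
Qed.

End AlgebraicValues.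

(** * Limits along an ultrafilter *)

(** An ultrafilter that contains the tails: by compactness of segments it maps
    to a convergent filter under every bounded sequence. *)
Lemma ultralimit (R : realType) : exists F : set_system nat,
  [/\ ProperFilter F, eventually `<=` F
    & forall (u : nat -> R) (B : R), (\forall k \near F, `|u k| <= B) ->
      exists l : R, u k @[k --> F] --> l].
Proof.
have [F [FU sF]] := ultraFilterLemma (eventually_filter).
have FF : ProperFilter F := ultra_proper.
exists F; split; [exact: FF|exact: sF|move=> u B uB].
have UuF : UltraFilter (u @ F).
  split; first exact: fmap_proper_filter.
  move=> G GF sG; apply/seteqP; split=> // A GA.
  have [//|FnA] := in_ultra_setVsetC (u @^-1` A) FU.
  have /filter_ex[x []//] : G (A `&` ~` A) by apply: filterI => //; exact: sG.
have := @segment_compact R (- B) B; rewrite compact_ultra => /(_ _ UuF)[|l [_ ul]].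
  by apply: (filterS _ uB) => k /=; rewrite ler_norml in_itv.
by exists l.
Qed.

(** A minimizing sequence converges pointwise along the filter of [ultralimit],
    whatever the index type [J]; it serves for points, for moment vectors and
    for functionals on all polynomials. *)
Lemma attain_min (R : realType) (J : Type) (S : set (J -> R))
    (c : (J -> R) -> R) :
    S !=set0 ->
    (forall j, exists B, forall y, S y -> `|y j| <= B) ->
    (exists B, forall y, S y -> B <= c y) ->
    (forall F : set_system nat, ProperFilter F -> forall u y,
      (forall k, S (u k)) -> (forall j, u k j @[k --> F] --> y j) ->
      S y /\ c (u k) @[k --> F] --> c y) ->
  exists z, optimizer S c z.
Proof.
move=> [y0 Sy0] bnd [B cB] closedS.
have [F [FF sF Fcvg]] := ultralimit R.
pose m := inf (c @` S).
have cinf : has_inf (c @` S).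
  by split; [exists (c y0), y0|exists B => _ [y Sy <-]; exact: cB].
have minf y : S y -> m <= c y by move=> Sy; apply: ge_inf; [exact: cinf.2|exists y].
have /choice[u uP] k : exists y, S y /\ c y < m + k.+1%:R^-1.
  have [|_ [y Sy <-] lt] := @inf_adherent R (c @` S) k.+1%:R^-1 _ cinf.
    by rewrite invr_gt0 ltr0n.
  by exists y.
have /choice[y uy] (j : J) : exists l : R, u k j @[k --> F] --> l.
  have [b Sb] := bnd j; apply: (Fcvg _ b); apply: nearW => k; apply: Sb.
  exact: (uP k).1.
have [Sy cy] := closedS F FF u y (fun k => (uP k).1) uy.
exists y; split=> // z Sz; apply: le_trans (minf _ Sz).
apply/ler_addgt0Pr => e e0; apply: cvgr_to_le cy _.
apply: sF; near=> k; apply/ltW/(lt_trans (uP k).2); rewrite ltrD2l.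
near: k; exact: near_infty_natSinv_lt (PosNum e0).
Unshelve. all: by end_near.
Qed.

Lemma cvg_bigsum (R : realType) (I T : Type) (F : set_system T) (r : seq I)
    (u : T -> I -> R) (l : I -> R) : Filter F ->
    (forall i, u k i @[k --> F] --> l i) ->
  \sum_(i <- r) u k i @[k --> F] --> \sum_(i <- r) l i.
Proof.
move=> FF ul; elim: r => [|i r IH].
  rewrite big_nil; under eq_fun do rewrite big_nil; exact: cvg_cst.
by rewrite big_cons; under eq_fun do rewrite big_cons; apply: cvgD.
Qed.

(** * Linear functionals and evaluations *)

Section Functionals.
Variables (R : realType) (n : nat).
Implicit Types (p q w f g h : {mpoly R[n]}) (L : {mpoly R[n]} -> R).
Implicit Types (C : set {mpoly R[n]}).

Definition lin L : Prop := forall a p q, L (a *: p + q) = a * L p + L q.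

Section Lin.
Variable L : {mpoly R[n]} -> R.
Hypothesis L_lin : lin L.

Lemma linD p q : L (p + q) = L p + L q.
Proof. by have := L_lin 1 p q; rewrite scale1r mul1r. Qed.

Lemma lin0 : L 0 = 0.
Proof. by apply: (addIr (L 0)); rewrite -linD !add0r. Qed.

Lemma linZ a p : L (a *: p) = a * L p.
Proof. by have := L_lin a p 0; rewrite addr0 lin0 addr0. Qed.

Lemma linN p : L (- p) = - L p.
Proof. by rewrite -scaleN1r linZ mulN1r. Qed.

Lemma linB p q : L (p - q) = L p - L q.
Proof. by rewrite linD linN. Qed.

Lemma lin_sum (I : Type) (r : seq I) (P : pred I) (F : I -> {mpoly R[n]}) :
  L (\sum_(i <- r | P i) F i) = \sum_(i <- r | P i) L (F i).
Proof.
elim: r => [|i r IH]; first by rewrite !big_nil lin0.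
by rewrite !big_cons; case: ifP => // _; rewrite linD IH.
Qed.

Lemma linC c : L c%:MP = c * L 1.
Proof. by rewrite -linZ -mul_mpolyC mulr1. Qed.

Lemma lin_mpolyE p : L p = \sum_(a <- msupp p) p@_a * L 'X_[a].
Proof. by rewrite {1}[p]mpolyE lin_sum; apply: eq_bigr => a _; rewrite linZ. Qed.

Lemma lin_mul2l q : lin (fun p => L (q * p)).
Proof. by move=> a p p'; rewrite mulrDr -scalerAr L_lin. Qed.

Lemma lin_sqrD p q t :
  L ((p + t *: q) ^+ 2) = L (p ^+ 2) + (2 * t * L (p * q) + t ^+ 2 * L (q ^+ 2)).
Proof.
have -> : (p + t *: q) ^+ 2 = p ^+ 2 + (2 * t *: (p * q) + t ^+ 2 *: q ^+ 2).
  by rewrite -!mul_mpolyC mpolyCM (mpolyC_nat _ _ 2) mpolyCM; ring.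
by rewrite 2!linD !linZ.
Qed.

End Lin.

Lemma quadratic_ge0_linear0 (b c : R) :
  (forall t, 0 <= 2 * t * b + t ^+ 2 * c) -> b = 0.
Proof.
move=> h; have h1 := h 1; have h2 := h (-1).
have c0 : 0 <= c by nra.
have := h (- b / (c + 1)); have c1 : 0 < c + 1 by lra.
set u := - b / (c + 1); have bE : b = - u * (c + 1).
  by rewrite /u; field; lra.
rewrite bE => h3; have : u = 0 by nra.
by move=> ->; ring.
Qed.

Lemma mdeg_split (a : 'X_{1..n}) k k' : (mdeg a <= k + k')%N ->
  exists b c, [/\ a = (b + c)%MM, (mdeg b <= k)%N & (mdeg c <= k')%N].
Proof.
elim: k a => [|k IH] a ak; first by exists 0%MM, a; rewrite add0m mdeg0.
have [->|a0] := eqVneq a 0%MM.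
  by exists 0%MM, 0%MM; rewrite add0m mdeg0.
have [i ai] : exists i, a i != 0%N.
  apply/existsP; apply: contraNT a0; rewrite negb_exists => /forallP h.
  by apply/eqP/mnmP => i; rewrite mnm0E; apply/eqP/negPn.
have aE := submK (etrans (lep1mP i a) ai).
have ad : mdeg a = (mdeg (a - U_(i))%MM).+1 by rewrite -{1}aE mdegD mdeg1 addn1.
have [|b [c [bc bk ck]]] := IH (a - U_(i))%MM; first by rewrite -ltnS -ad.
exists (b + U_(i))%MM, c; split=> //; last by rewrite mdegD mdeg1 addn1.
by rewrite -addmA [(U_(i) + c)%MM]addmC addmA -bc aE.
Qed.

(** On the unit ball every monomial is at most 1 in absolute value; this is
    already visible on moments of finite order, by Cauchy-Schwarz and by
    testing the ball constraint against squares of monomials. *)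
Lemma moment_bound L k : lin L -> L 1 = 1 ->
    (forall w, (msize w <= k.+1)%N -> 0 <= L (w ^+ 2)) ->
    (forall w, (msize w <= k)%N -> 0 <= L (ballpoly R n * w ^+ 2)) ->
  forall a : 'X_{1..n}, (mdeg a <= k.*2)%N -> `|L 'X_[a]| <= 1.
Proof.
move=> L_lin L1 Lsq Lball.
have sqX_le1 (a : 'X_{1..n}) : (mdeg a <= k)%N -> L ('X_[a] ^+ 2) <= 1.
  move: {2}(mdeg a) (erefl (mdeg a)) => d; elim: d a => [|d IH] a ad ak.
    by move/eqP: ad; rewrite mdeg_eq0 => /eqP->; rewrite mpolyX0 expr1n L1.
  have [i ai] : exists i, a i != 0%N.
    apply/existsP; apply: contraTT isT; rewrite negb_exists => /forallP h.
    have a0 : a = 0%MM by apply/mnmP => i; rewrite mnm0E; apply/eqP/negPn.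
    by move: ad; rewrite a0 mdeg0.
  have aE := submK (etrans (lep1mP i a) ai).
  set b := (a - U_(i))%MM in aE.
  have bd : mdeg b = d.
    by apply/eqP; rewrite -eqSS -ad -aE mdegD mdeg1 addn1.
  have bk : (mdeg b < k)%N by rewrite bd -ad.
  apply: le_trans (IH b bd (ltnW bk)).
  have := Lball 'X_[b]; rewrite msizeX => /(_ bk).
  rewrite /ballpoly mulrBl mul1r (linB L_lin) mulr_suml (lin_sum L_lin) subr_ge0.
  apply: le_trans; rewrite (bigD1 i) //= -exprMn -mpolyXD addmC aE lerDl.
  apply: sumr_ge0 => j _; rewrite -exprMn; apply: Lsq.
  by rewrite -mpolyXD msizeX mdegD mdeg1 add1n ltnS.
move=> a; rewrite -addnn => /mdeg_split[b [c [-> bk ck]]].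
have h t := Lsq ('X_[b] + t *: 'X_[c]); rewrite mpolyXD.
have sz t : (msize ('X_[b] + t *: 'X_[c] : {mpoly R[n]}) <= k.+1)%N.
  rewrite (leq_trans (msizeD_le _ _)) // geq_max msizeX ltnS bk /=.
  by rewrite (leq_trans (msizeZ_le _ _)) // msizeX ltnS.
have h1 := h 1 (sz 1); have h2 := h (-1) (sz (-1)).
rewrite !(lin_sqrD L_lin) in h1 h2.
have hb := sqX_le1 b bk; have hc := sqX_le1 c ck.
by rewrite ler_norml; apply/andP; split; lra.
Qed.

Definition norm1 p : R := \sum_(a <- msupp p) `|p@_a|.

Lemma lin_le_norm1 L p : lin L ->
  (forall a, a \in msupp p -> `|L 'X_[a]| <= 1) -> `|L p| <= norm1 p.
Proof.
move=> L_lin LX; rewrite (lin_mpolyE L_lin) /norm1.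
apply: le_trans (ler_norm_sum _ _ _) _.
rewrite !big_seq; apply: ler_sum => a ap; rewrite normrM ler_piMr //.
exact: LX.
Qed.

(** A linear functional of mass 1 that is nonnegative on the quadratic module
    generated by [C]. *)
Definition is_state C L : Prop :=
  [/\ lin L, L 1 = 1, forall w, 0 <= L (w ^+ 2)
    & forall g w, C g -> 0 <= L (g * w ^+ 2)].

Lemma state_le_norm1 C L p : C (ballpoly R n) -> is_state C L -> `|L p| <= norm1 p.
Proof.
move=> Cball [L_lin L1 Lsq LC]; apply: lin_le_norm1 => // a _.
apply: (moment_bound (k := mdeg a)) => // [w _|].
  exact: LC.
by rewrite -addnn leq_addr.
Qed.

Definition fix_value C f (s : R) : set {mpoly R[n]} :=
  C `|` [set f - s%:MP; s%:MP - f].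

(** Equations tested on squares hold against every polynomial [q], because
    [4 q = (q + 1)^2 - (q - 1)^2]. *)
Lemma state_kills C L g : C g -> C (- g) -> is_state C L -> forall q, L (g * q) = 0.
Proof.
move=> Cg CNg [L_lin L1 Lsq LC] q.
have g0 w : L (g * w ^+ 2) = 0.
  apply: le_anti; rewrite LC // andbT.
  by have := LC _ w CNg; rewrite mulNr (linN L_lin) oppr_ge0.
have := g0 (q + 1).
have -> : g * (q + 1) ^+ 2 = g * q ^+ 2 + (2 *: (g * q) + g * 1 ^+ 2).
  by rewrite -mul_mpolyC (mpolyC_nat _ _ 2); ring.
rewrite !(linD L_lin) !g0 (linZ L_lin) add0r addr0 => /eqP.
by rewrite mulf_eq0 pnatr_eq0 => /eqP.
Qed.

(** The degenerate case of the Cauchy-Schwarz inequality. *)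
Lemma square_kills L p q : lin L -> (forall t, 0 <= L ((p + t *: q) ^+ 2)) ->
  L (p ^+ 2) = 0 -> L (p * q) = 0.
Proof.
move=> L_lin Lsq p0; apply: (quadratic_ge0_linear0 (c := L (q ^+ 2))) => t.
by have := Lsq t; rewrite lin_sqrD // p0 add0r.
Qed.

(** A state that minimizes [f] gives [f] a definite value: reweighting it by
    the density [(1 + t h)^2] yields states again, and minimality for small [t]
    of either sign forces the first order term [L (h * (f - L f))] to vanish. *)
Lemma minimizing_state_definite C L f : is_state C L ->
    (forall L', is_state C L' -> L f <= L' f) -> is_state (fix_value C f (L f)) L.
Proof.
move=> [L_lin L1 Lsq LC] Lmin; set g := f - (L f)%:MP.
have gsq w : 0 <= L (g * w ^+ 2).
  have gE : L (g * w ^+ 2) = L (w ^+ 2 * f) - L f * L (w ^+ 2).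
    rewrite mulrC mulrBr (linB L_lin) [X in _ - L X]mulrC.
    by rewrite mul_mpolyC (linZ L_lin).
  have [w0|w0] := eqVneq (L (w ^+ 2)) 0.
    rewrite gE w0 mulr0 subr0 expr2 -mulrA.
    rewrite (square_kills (q := w * f)) // => t; exact: Lsq.
  have wp : 0 < L (w ^+ 2) by rewrite lt_def w0 Lsq.
  have /Lmin : is_state C (fun q => L (w ^+ 2 * q) / L (w ^+ 2)).
    split=> [a p q||v|h v Ch].
    - by rewrite (lin_mul2l L_lin) mulrDl mulrA.
    - by rewrite mulr1 divff.
    - by rewrite divr_ge0 // -exprMn.
    - by rewrite divr_ge0 // mulrCA -exprMn LC.
  by rewrite ler_pdivlMr // gE subr_ge0.
have g0 : L g = 0 by rewrite (linB L_lin) (linC L_lin) L1 mulr1 subrr.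
have gq h : L (g * h) = 0.
  apply: (quadratic_ge0_linear0 (c := L (g * h ^+ 2))) => t.
  have := gsq (1 + t *: h).
  rewrite (lin_sqrD (lin_mul2l L_lin g)) expr1n mulr1 g0 add0r mul1r.
  by [].
split=> // q w [Cq|[->|->]]; first exact: LC.
- by rewrite gq.
- by rewrite -opprB mulNr (linN L_lin) gq oppr0.
Qed.

Lemma state_closed C (F : set_system nat) (u : nat -> {mpoly R[n]} -> R) L :
    ProperFilter F -> (forall k, lin (u k)) -> (forall k, u k 1 = 1) ->
    (forall w, \forall k \near F, 0 <= u k (w ^+ 2)) ->
    (forall g w, C g -> \forall k \near F, 0 <= u k (g * w ^+ 2)) ->
    (forall q, u k q @[k --> F] --> L q) -> is_state C L.
Proof.
move=> FF ulin u1 usq uC uL; split=> [a p q||w|g w Cg].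
- apply: (cvg_unique _ (uL (a *: p + q))); first exact: Rhausdorff.
  have -> : (fun k => u k (a *: p + q)) = (fun k => a * u k p + u k q).
    by apply/funext => k; rewrite ulin.
  by apply: cvgD => //; apply: cvgM => //; apply: cvg_cst.
- apply: (cvg_unique _ (uL 1)); first exact: Rhausdorff.
  have -> : (fun k => u k 1) = (fun=> 1) by apply/funext.
  exact: cvg_cst.
- by apply: cvgr_to_ge (uL _) _; apply: usq.
- by apply: cvgr_to_ge (uL _) _; apply: uC.
Qed.

(** States are compact for pointwise convergence, so a state can always be
    replaced by one that gives [f] a definite value which is not larger. *)
Lemma minimizing_state C L f : C (ballpoly R n) -> is_state C L ->
  exists L', [/\ is_state C L', L' f <= L f & is_state (fix_value C f (L' f)) L'].
Proof.
move=> Cball CL.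
have bnd q : exists B, forall L, is_state C L -> `|L q| <= B.
  by exists (norm1 q) => L' /(state_le_norm1 q Cball).
have [|F FF u y Su uy|L' [CL' L'min]] :=
  attain_min (S := is_state C) (c := fun L => L f) (ex_intro _ L CL) bnd.
- exists (- norm1 f) => L' /(state_le_norm1 f Cball).
  by rewrite ler_norml => /andP[].
- split; last exact: uy.
  apply: (state_closed FF) uy => k; try by case: (Su k).
  + by move=> *; apply: nearW => j; case: (Su j).
  + by move=> *; apply: nearW => j; case: (Su j) => _ _ _; apply.
exists L'; split=> //; first exact: L'min.
exact: minimizing_state_definite.
Qed.

Lemma state_refine C L (fs : seq {mpoly R[n]}) : C (ballpoly R n) -> is_state C L ->
  exists C' L', [/\ C `<=` C', is_state C' L'
    & forall f, f \in fs -> exists s : R, C' (f - s%:MP) /\ C' (s%:MP - f)].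
Proof.
elim: fs C L => [|f fs IH] C L Cball CL; first by exists C, L; split.
have [L1 [_ _ CL1]] := minimizing_state f Cball CL.
have [|C' [L' [sC' CL' C'fs]]] := IH _ _ _ CL1; first by left.
exists C', L'; split=> // [g Cg|g]; first by apply: sC'; left.
rewrite inE => /predU1P[->|/C'fs//]; exists (L1 f).
by split; apply: sC'; right; [left|right].
Qed.

(** Evaluations suffice to bound linear functionals that are nonnegative on
    the constraints: minimizing [f] and then each coordinate gives every
    coordinate a definite value, hence produces a point. *)
Lemma state_point C L f : C (ballpoly R n) -> is_state C L ->
  exists x : 'I_n -> R, (forall g, C g -> 0 <= g.@[x]) /\ f.@[x] <= L f.
Proof.
move=> Cball CL.
have [L0 [_ L0f CL0]] := minimizing_state f Cball CL.
have [|C' [L' [sC' CL' C'X]]] :=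
  state_refine [seq 'X_i | i <- enum 'I_n] _ CL0; first by left.
have /choice[x xP] (i : 'I_n) :
    exists s : R, C' ('X_i - s%:MP) /\ C' (s%:MP - 'X_i).
  by apply: C'X; apply: map_f; rewrite mem_enum.
have [L_lin L1 Lsq LC] := CL'.
have L'eval q : forall r, L' (q * r) = q.@[x] * L' r.
  elim/mpoly_ring_ind: q => [c|i|p q IHp IHq|p q IHp IHq] r.
  - by rewrite mul_mpolyC (linZ L_lin) mevalC.
  - have [Cx CNx] := xP i; rewrite -opprB in CNx.
    have := state_kills Cx CNx CL' r.
    rewrite mulrBl (linB L_lin) mul_mpolyC (linZ L_lin) mevalXU => /eqP.
    by rewrite subr_eq0 => /eqP.
  - by rewrite mulrDl (linD L_lin) IHp IHq mevalD mulrDl.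
  - by rewrite -mulrA IHp IHq mevalM mulrA.
have L'E q : L' q = q.@[x] by rewrite -[LHS]/(L' q) -{1}[q]mulr1 L'eval L1 mulr1.
exists x; split=> [g Cg|].
  have := LC g 1 (sC' g (or_introl Cg)).
  by rewrite L'E mevalM expr1n meval1 mulr1.
have Cf : C' (f - (L0 f)%:MP) by apply: sC'; right; left.
have CNf : C' (- (f - (L0 f)%:MP)) by apply: sC'; right; right; rewrite opprB.
have /eqP := state_kills Cf CNf CL' 1.
by rewrite mulr1 L'E mevalB mevalC subr_eq0 => /eqP->.
Qed.

End Functionals.

(** * Moment relaxations *)

Section Localizing.
Variables (R : realType) (n k : nat).
Implicit Types (p q w : {mpoly R[n]}) (y : momvec R n k.*2).

Lemma pairing_lin (d : nat) (y : momvec R n d) : lin (fun p => pairing p y).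
Proof.
move=> a p q; rewrite /pairing mulr_sumr -big_split; apply: eq_bigr => b _ /=.
by rewrite mcoeffD mcoeffZ mulrDl mulrA.
Qed.

Lemma pairingX (d : nat) (y : momvec R n d) (a : 'X_{1..n < d.+1}) :
  pairing 'X_[a] y = y a.
Proof.
rewrite /pairing (bigD1 a) //= big1 => [|b ba].
  by rewrite mcoeffX eqxx mul1r addr0.
by rewrite mcoeffX -bmeqP eq_sym (negPf ba) mul0r.
Qed.

Lemma pairing1 (d : nat) (y : momvec R n d) : pairing 1 y = y bm0.
Proof. by rewrite -pairingX mpolyX0. Qed.

Definition point_moments (d : nat) (x : 'I_n -> R) : momvec R n d :=
  fun a => 'X_[R, bmnm a].@[x].

Lemma pairing_point (d : nat) (x : 'I_n -> R) p : (msize p <= d.+1)%N ->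
  pairing p (@point_moments d x) = p.@[x].
Proof.
move=> sp; rewrite [in RHS](mpolywE sp) raddf_sum; apply: eq_bigr => a _ /=.
by rewrite mevalZ.
Qed.

Definition test_poly (t : nat) (v : 'cV[R]_#|{: 'X_{1..n < t.+1}}|) :
    {mpoly R[n]} :=
  \sum_i v i 0 *: 'X_[bmnm (enum_val i)].

Lemma msize_test_poly t (v : 'cV[R]_#|{: 'X_{1..n < t.+1}}|) :
  (msize (test_poly v) <= t.+1)%N.
Proof.
apply: (big_ind (fun p : {mpoly R[n]} => (msize p <= t.+1)%N)).
- by rewrite msize0.
- by move=> p q sp sq; rewrite (leq_trans (msizeD_le _ _)) // geq_max sp.
- move=> i _; rewrite (leq_trans (msizeZ_le _ _)) // msizeX.
  exact: (bmdeg (enum_val i)).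
Qed.

Lemma test_polyP t w : (msize w <= t.+1)%N -> exists v, w = @test_poly t v.
Proof.
move=> sw; exists (\col_i w@_(bmnm (enum_val i))); rewrite {1}(mpolywE sw).
rewrite [LHS](reindex (@enum_val _ {: 'X_{1..n < t.+1}})) /=; last first.
  by apply: onW_bij; apply: enum_val_bij.
by apply: eq_bigr => i _; rewrite mxE.
Qed.

Lemma locmxE q y i j : locmx q y i j =
  pairing (q * ('X_[bmnm (enum_val i)] * 'X_[bmnm (enum_val j)])) y.
Proof.
rewrite /locmx summxE; apply: eq_bigr => a _.
by rewrite !mxE big_ord1 !mxE mulrC.
Qed.

(** Localizing matrices are the Gram matrices of the forms
    [(w, w') |-> pairing (q * w * w') y]; all the constraints of the programs
    are used in this form. *)
Lemma locmx_form q y (v v' : 'cV_#|{: 'X_{1..n < (k - halfdeg q).+1}}|) :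
  (v^T *m locmx q y *m v') 0 0 = pairing (q * (test_poly v * test_poly v')) y.
Proof.
have pl := pairing_lin y.
rewrite /test_poly big_distrlr mulr_sumr (lin_sum pl) mxE.
under eq_bigr do rewrite mxE mulr_suml.
rewrite exchange_big; apply: eq_bigr => i _.
rewrite mulr_sumr (lin_sum pl); apply: eq_bigr => j _.
rewrite locmxE mxE /= -!mul_mpolyC.
set X := 'X_[_]; set Y := 'X_[_].
have -> : q * ((v i 0)%:MP * X * ((v' j 0)%:MP * Y))
        = (v i 0)%:MP * ((v' j 0)%:MP * (q * (X * Y))) by ring.
by rewrite !mul_mpolyC !(linZ pl); ring.
Qed.

Lemma loc_psdP q y : loc_psd q y <-> ((halfdeg q <= k)%N ->
  forall w, (msize w <= (k - halfdeg q).+1)%N -> 0 <= pairing (q * w ^+ 2) y).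
Proof.
split=> h qk; have {}h := h qk.
  by move=> w /test_polyP[v ->]; rewrite expr2 -locmx_form; apply: h.2.
split=> [|v]; first by apply/matrixP => i j; rewrite mxE !locmxE [X in _ * X]mulrC.
by rewrite locmx_form -expr2; apply: h; apply: msize_test_poly.
Qed.

Lemma loc_zeroP q y : loc_zero q y <-> ((halfdeg q <= k)%N ->
  forall w w', (msize w <= (k - halfdeg q).+1)%N ->
    (msize w' <= (k - halfdeg q).+1)%N -> pairing (q * (w * w')) y = 0).
Proof.
split=> h qk; have {}h := h qk.
  move=> w w' /test_polyP[v ->] /test_polyP[v' ->].
  by rewrite -locmx_form h mulmx0 mul0mx mxE.
apply/matrixP => i j; rewrite locmxE mxE; apply: h; rewrite msizeX.
  exact: (bmdeg (enum_val i)).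
exact: (bmdeg (enum_val j)).
Qed.

End Localizing.

Lemma mommxP (R : realType) (n k : nat) (y : momvec R n k.*2) :
  psd (mommx y) <->
  forall w : {mpoly R[n]}, (msize w <= k.+1)%N -> 0 <= pairing (w ^+ 2) y.
Proof.
have hd1 : halfdeg (1 : {mpoly R[n]}) = 0%N by rewrite /halfdeg /degp msize1.
have hk : (halfdeg (1 : {mpoly R[n]}) <= k)%N by rewrite hd1.
split=> [h w wk|h].
  rewrite -[w ^+ 2]mul1r; apply: (loc_psdP 1 y).1 => //.
  by rewrite hd1 subn0.
apply: (loc_psdP 1 y).2 => // _ w; rewrite hd1 subn0 mul1r; exact: h.
Qed.

Lemma msizeM_bound (R : idomainType) (n a b : nat) (p q : {mpoly R[n]}) :
  (msize p <= a.+1)%N -> (msize q <= b.+1)%N -> (msize (p * q) <= (a + b).+1)%N.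
Proof.
have [->|p0] := eqVneq p 0; first by rewrite mul0r msize0.
have [->|q0] := eqVneq q 0; first by rewrite mulr0 msize0.
by rewrite msizeM_proper ?mulf_neq0 ?mleadc_eq0 //; lia.
Qed.

Section MomentProgram.
Variables (R : realType) (n : nat) (E C : set {mpoly R[n]}).
Implicit Types (p q w g h : {mpoly R[n]}).

(** The common shape of the semidefinite programs: moment relaxations of the
    constraints [h = 0] for [h] in [E] and [0 <= g] for [g] in [C]. *)
Definition moment_feasible (k : nat) : set (momvec R n k.*2) :=
  [set y | [/\ forall h, E h -> loc_zero h y, forall g, C g -> loc_psd g y,
    y bm0 = 1 & psd (mommx y)]].

Lemma halfdeg_le q d : (msize q <= d.*2.+1)%N -> (halfdeg q <= d)%N.
Proof.
by rewrite /halfdeg leq_uphalf_double /degp; case: (msize q).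
Qed.

Lemma msize_halfdeg q : (msize q <= (halfdeg q).*2.+1)%N.
Proof.
by rewrite /halfdeg uphalfK /degp; case: (msize q) => // s; rewrite ltnS leq_addl.
Qed.

Lemma moment_feasible_point k (x : 'I_n -> R) :
    (forall h, E h -> h.@[x] = 0) -> (forall g, C g -> 0 <= g.@[x]) ->
  moment_feasible (@point_moments R n k.*2 x).
Proof.
move=> Ex Cx.
have msz q w w' : (halfdeg q <= k)%N -> (msize w <= (k - halfdeg q).+1)%N ->
    (msize w' <= (k - halfdeg q).+1)%N -> (msize (q * (w * w')) <= k.*2.+1)%N.
  move=> qk wk w'k.
  have -> : k.*2 = ((halfdeg q).*2 + ((k - halfdeg q) + (k - halfdeg q)))%N by lia.
  by apply: msizeM_bound; [exact: msize_halfdeg|exact: msizeM_bound].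
have sqx g w : 0 <= g.@[x] -> (halfdeg g <= k)%N ->
    (msize w <= (k - halfdeg g).+1)%N ->
    0 <= pairing (g * w ^+ 2) (@point_moments R n k.*2 x).
  move=> gx gk wk; rewrite pairing_point; last by rewrite expr2; apply: msz.
  by rewrite mevalM rmorphXn mulr_ge0 // sqr_ge0.
split.
- move=> h Eh; apply/loc_zeroP => hk w w' wk w'k.
  by rewrite pairing_point ?msz // mevalM Ex // mul0r.
- by move=> g Cg; apply/loc_psdP => gk w wk; apply: sqx => //; apply: Cx.
- by rewrite /point_moments /= mpolyX0 meval1.
- apply/mommxP => w wk; rewrite -[w ^+ 2]mul1r.
  have hd1 : halfdeg (1 : {mpoly R[n]}) = 0%N by rewrite /halfdeg /degp msize1.
  by apply: sqx; rewrite ?meval1 ?hd1 ?subn0.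
Qed.

Section Feasible.
Variables (k : nat) (y : momvec R n k.*2).
Hypothesis y_feas : moment_feasible y.

Lemma feasible_sqr w : (msize w <= k.+1)%N -> 0 <= pairing (w ^+ 2) y.
Proof.
by case: y_feas => _ _ _ /mommxP; apply.
Qed.

Lemma feasible_psd g w : C g -> (halfdeg g <= k)%N ->
  (msize w <= (k - halfdeg g).+1)%N -> 0 <= pairing (g * w ^+ 2) y.
Proof. by case: y_feas => _ h _ _ /h/loc_psdP hg gk; apply: hg. Qed.

Lemma feasible_zero h w : E h -> (halfdeg h <= k)%N ->
  (msize w <= (k - halfdeg h).+1)%N -> pairing (h * w) y = 0.
Proof.
case: y_feas => Eh _ _ _ /Eh/loc_zeroP hE hk wk; rewrite -[w]mulr1.
by apply: hE => //; rewrite msize1.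
Qed.

Lemma feasible_pairing1 : pairing 1 y = 1.
Proof. by rewrite pairing1; case: y_feas. Qed.

Hypothesis ball : C (ballpoly R n).

Lemma halfdeg_ball : (halfdeg (ballpoly R n) <= 1)%N.
Proof.
apply: halfdeg_le; rewrite /ballpoly (leq_trans (msizeD_le _ _)) // geq_max.
rewrite msize1 msizeN (leq_trans (msize_sum _ _ _)) //.
by apply/bigmax_leqP => i _; rewrite mpolyXn msizeX mdegMn mdeg1.
Qed.

Lemma feasible_moment_bound (a : 'X_{1..n}) :
  (mdeg a <= k.*2)%N -> `|pairing 'X_[a] y| <= 1.
Proof.
have := halfdeg_ball => hb.
apply: (@moment_bound R n (fun p => pairing p y) k) => [||w|w sw].
- exact: pairing_lin.
- exact: feasible_pairing1.
- exact: feasible_sqr.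
- have [k0|k0] := posnP k.
    have -> : w = 0 by apply/eqP; rewrite -msize_poly_eq0 -leqn0 -k0.
    by rewrite expr0n mulr0 (lin0 (pairing_lin y)).
  apply: feasible_psd => //; first exact: leq_trans hb _.
  by apply: leq_trans sw _; lia.
Qed.

End Feasible.

Lemma moment_feasible_optimizer k f : C (ballpoly R n) ->
  @moment_feasible k !=set0 ->
  exists y, optimizer (@moment_feasible k) (fun y => pairing f y) y.
Proof.
move=> ball Fk0.
have y1 y a : moment_feasible y -> `|(y : momvec R n k.*2) a| <= 1.
  move=> yF; rewrite -pairingX; apply: feasible_moment_bound => //.
  by rewrite -ltnS (bmdeg a).
apply: (attain_min Fk0) => [a||F FF u y uF uy].
- by exists 1 => y; apply: y1.
- exists (- \sum_(a : 'X_{1..n < k.*2.+1}) `|f@_a|) => y yF.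
  rewrite -lerNl (le_trans (ler_norm _)) // normrN.
  apply: le_trans (ler_norm_sum _ _ _) _; apply: ler_sum => a _.
  by rewrite normrM ler_piMr // y1.
have pcvg p : pairing p (u j) @[j --> F] --> pairing p y.
  by apply: cvg_bigsum => a; apply: cvgM => //; apply: cvg_cst.
split=> //; split.
- move=> h Eh; apply/loc_zeroP => hk w w' wk w'k.
  apply: (cvg_unique _ (pcvg _)); first exact: Rhausdorff.
  have -> : (fun j => pairing (h * (w * w')) (u j)) = (fun=> 0).
    by apply/funext => j; have [/(_ _ Eh)/loc_zeroP->] := uF j.
  exact: cvg_cst.
- move=> g Cg; apply/loc_psdP => gk w wk; apply: cvgr_to_ge (pcvg _) _.
  by apply: nearW => j; apply: feasible_psd.
- rewrite -pairing1; apply: (cvg_unique _ (pcvg _)); first exact: Rhausdorff.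
  have -> : (fun j => pairing 1 (u j)) = (fun=> 1).
    by apply/funext => j; apply: feasible_pairing1.
  exact: cvg_cst.
- apply/mommxP => w wk; apply: cvgr_to_ge (pcvg _) _.
  by apply: nearW => j; apply: feasible_sqr.
Qed.

End MomentProgram.

(** * Finite convergence *)

Section PolyAt.
Variables (R : fieldType) (n : nat) (f : {mpoly R[n]}).

Lemma poly_atD G H : poly_at f (G + H) = poly_at f G + poly_at f H.
Proof. by rewrite /poly_at rmorphD hornerD. Qed.

Lemma poly_atM G H : poly_at f (G * H) = poly_at f G * poly_at f H.
Proof. by rewrite /poly_at rmorphM hornerM. Qed.

Lemma poly_at1 : poly_at f 1 = 1.
Proof. by rewrite /poly_at rmorph1 hornerC. Qed.

Lemma poly_atXsubC v N : poly_at f (('X - v%:P) ^+ N) = (f - v%:MP) ^+ N.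
Proof.
by rewrite /poly_at rmorphXn rmorphB /= map_polyX map_polyC horner_exp hornerXsubC.
Qed.

Lemma meval_poly_at G x : (poly_at f G).@[x] = G.[f.@[x]].
Proof.
rewrite /poly_at -(horner_map (meval x)) -map_poly_comp.
by rewrite map_poly_id // => c _; apply: mevalC.
Qed.

End PolyAt.

Section AsymptoticStates.
Variables (R : realType) (n : nat).
Implicit Types (p q w f g h : {mpoly R[n]}) (C E : set {mpoly R[n]}).
Implicit Types (u : nat -> {mpoly R[n]} -> R).

(** The conditions of a state for test polynomials of bounded degree, from some
    index on.  This index is uniform over the polynomials of a given degree, as
    arguments of Cauchy-Schwarz type require. *)
Definition asymptotic_state C u : Prop :=
  [/\ forall j, lin (u j), forall j, u j 1 = 1
    & forall g d, (1 |` C) g ->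
        \forall j \near \oo, forall w, (msize w <= d)%N -> 0 <= u j (g * w ^+ 2)].

Lemma asymptotic_square C u d : asymptotic_state C u ->
  \forall j \near \oo, forall w, (msize w <= d)%N -> 0 <= u j (w ^+ 2).
Proof.
case=> _ _ /(_ 1 d (or_introl erefl)); apply: filterS => j h w wd.
by rewrite -[w ^+ 2]mul1r; apply: h.
Qed.

Lemma asymptotic_bound C u q : C (ballpoly R n) -> asymptotic_state C u ->
  \forall j \near \oo, `|u j q| <= norm1 q.
Proof.
move=> Cball Cu; have [ulin u1 uC] := Cu.
have sq := asymptotic_square (msize q).+1 Cu.
have ball := uC _ (msize q) (or_intror Cball).
near=> j; apply: lin_le_norm1 => // a aq.
apply: (@moment_bound R n (u j) (msize q)) => //.
- by near: j.
- by near: j.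
- by rewrite (leq_trans (ltnW (msize_mdeg_lt aq))) // -addnn leq_addr.
Unshelve. all: by end_near.
Qed.

Lemma asymptotic_limit C u : C (ballpoly R n) -> asymptotic_state C u ->
  exists (F : set_system nat) (L : {mpoly R[n]} -> R),
    [/\ ProperFilter F, eventually `<=` F, forall q, u j q @[j --> F] --> L q
      & is_state C L].
Proof.
move=> Cball Cu; have [ulin u1 uC] := Cu.
have [F [FF sF Fcvg]] := ultralimit R.
have /choice[L uL] q : exists l : R, u j q @[j --> F] --> l.
  by apply: (Fcvg _ (norm1 q)); apply: sF; exact: (asymptotic_bound q Cball Cu).
exists F, L; split=> //; apply: (state_closed FF) uL => // [w|g w Cg].
  by apply: sF; apply: filterS (asymptotic_square (msize w) Cu) => j; apply.
by apply: sF; apply: filterS (uC g (msize w) (or_intror Cg)) => j; apply.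
Qed.

(** Equations are read as pairs of opposite inequalities. *)
Definition both_signs C E : set {mpoly R[n]} := C `|` E `|` [set h | E (- h)].

Lemma feasible_asymptotic E C (k : nat -> nat)
    (y : forall j, momvec R n (k j).*2) :
    (forall j, (j <= k j)%N) -> (forall j, moment_feasible E C (y j)) ->
  asymptotic_state (both_signs C E) (fun j q => pairing q (y j)).
Proof.
move=> jk yF; split=> [j|j|g d Cg]; first exact: pairing_lin.
  exact: feasible_pairing1 (yF j).
near=> j => w wd.
have jE (h : nat) : (h <= j)%N -> (h <= k j)%N by move/leq_trans; apply.
have zero h : E h -> (halfdeg h + d.*2 <= j)%N -> pairing (h * w ^+ 2) (y j) = 0.
  move=> Eh /jE hk; apply: (feasible_zero (yF j)) => //.
    exact: leq_trans (leq_addr _ _) hk.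
  have wd' : (msize w <= d.+1)%N by rewrite ltnW.
  have := msizeM_bound wd' wd'; rewrite -expr2 addnn => /leq_trans; apply.
  by rewrite ltnS leq_subRL ?hk // (leq_trans (leq_addr _ _) hk).
case: Cg => [->|[[Cg|Eg]|Eg]].
- rewrite mul1r; apply: (feasible_sqr (yF j)).
  by rewrite (leq_trans wd) // ltnW // ltnS jE //; near: j; exists d.
- have gj : (halfdeg g + d <= k j)%N.
    by apply: jE; near: j; exists (halfdeg g + d)%N.
  by apply: (feasible_psd (yF j)) => //; lia.
- by rewrite zero //; near: j; exists (halfdeg g + d.*2)%N.
- rewrite -[g]opprK mulNr (linN (@pairing_lin _ _ _ (y j))) zero ?oppr0 //.
  by near: j; exists (halfdeg (- g) + d.*2)%N.
Unshelve. all: by end_near.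
Qed.

Lemma feasible_asymptotic_zero E C (k : nat -> nat)
    (y : forall j, momvec R n (k j).*2) h d :
    (forall j, (j <= k j)%N) -> (forall j, moment_feasible E C (y j)) -> E h ->
  \forall j \near \oo, forall q, (msize q <= d)%N -> pairing (h * q) (y j) = 0.
Proof.
move=> jk yF Eh; near=> j => q qd.
have hj : (halfdeg h + d <= k j)%N.
  by apply: leq_trans (jk j); near: j; exists (halfdeg h + d)%N.
by apply: (feasible_zero (yF j)) => //; lia.
Unshelve. all: by end_near.
Qed.

Section LowerBound.
Variables (C : set {mpoly R[n]}) (u : nat -> {mpoly R[n]} -> R).
Variables (f : {mpoly R[n]}) (v : R) (G : {poly R}).
Hypothesis Cball : C (ballpoly R n).
Hypothesis Cu : asymptotic_state C u.
Hypothesis G0 : G != 0.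
Hypothesis uG : forall d, \forall j \near \oo, forall q, (msize q <= d)%N ->
  u j (poly_at f G * q) = 0.
Hypothesis f_ge : forall x, (forall g, C g -> 0 <= g.@[x]) -> v <= f.@[x].

Let ulin j : lin (u j). Proof. by case: Cu => h _ _; apply: h. Qed.

Let uGq q : \forall j \near \oo, u j (poly_at f G * q) = 0.
Proof. by apply: filterS (uG (msize q)) => j; apply. Qed.

(** Nilpotents do not contribute: Cauchy-Schwarz halves the exponent. *)
Lemma asymptotic_nilpotent a q s :
    (\forall j \near \oo, u j (q ^+ 2 * s ^+ (2 ^ a)) = 0) ->
  \forall j \near \oo, u j (q ^+ 2 * s) = 0.
Proof.
elim: a => [|a IH]; first by rewrite expn0 expr1.
move=> h; apply: IH; set p := q * s ^+ (2 ^ a).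
have sq := asymptotic_square (maxn (msize p) (msize q)) Cu.
near=> j.
have -> : q ^+ 2 * s ^+ (2 ^ a) = p * q by rewrite /p; ring.
apply: square_kills => // [t|].
  have : forall w, (msize w <= maxn (msize p) (msize q))%N -> 0 <= u j (w ^+ 2).
    by near: j.
  apply; rewrite (leq_trans (msizeD_le _ _)) // geq_max leq_maxl /=.
  by rewrite (leq_trans (msizeZ_le _ _)) // leq_maxr.
have -> : p ^+ 2 = q ^+ 2 * s ^+ (2 ^ a.+1).
  by rewrite /p exprMn -exprM expnS mulnC.
by near: j.
Unshelve. all: by end_near.
Qed.

(** Finite convergence.  Split [1 = e + e'] according to the factorization
    [G = H * ('X - v)^N] with [H(v) != 0].  On the part of [e'] the difference
    [f - v] is nilpotent; on the part of [e] the functionals, reweighted by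
    [e^2], would converge to a state on the feasible points with [H(f) = 0], so
    with [f > v]. *)
Lemma asymptotic_lower_bound : \forall j \near \oo, v <= u j f.
Proof.
have [N [H]] := multiplicity_XsubC G v; rewrite G0 /= => Hv GE.
have /Bezout_eq1_coprimepP[[a b] /= abE] : coprimep H (('X - v%:P) ^+ N).
  by rewrite coprimep_expr // coprimep_XsubC.
set s := f - v%:MP.
pose e := poly_at f (b * ('X - v%:P) ^+ N).
pose e' := poly_at f (a * H).
have eE : e = poly_at f b * s ^+ N by rewrite /e poly_atM poly_atXsubC.
have GsE : poly_at f G = poly_at f H * s ^+ N.
  by rewrite GE poly_atM poly_atXsubC.
have e'E : e' * s ^+ N = poly_at f G * poly_at f a.
  by rewrite /e' poly_atM GsE; ring.
have eH : e * poly_at f H = poly_at f G * poly_at f b by rewrite eE GsE; ring.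
have ee' : e' + e = 1 by rewrite -poly_atD abE poly_at1.
(* [e' * s ^+ N] is a multiple of [G(f)]. *)
have e'0 : \forall j \near \oo, u j (e' ^+ 2 * s) = 0.
  apply: (asymptotic_nilpotent (a := N)).
  have Nle : (N <= 2 ^ N)%N by rewrite ltnW // ltn_expl.
  have -> : e' ^+ 2 * s ^+ (2 ^ N)
          = poly_at f G * (poly_at f a * (e' * s ^+ (2 ^ N - N))).
    by rewrite -{1}(subnKC Nle) exprD expr2 mulrACA e'E -mulrA.
  exact: uGq.
have e0 : \forall j \near \oo, 0 <= u j (e ^+ 2 * s).
  apply: contrapT => nge.
  pose D := maxn (msize e) (msize (e * s)).
  have /choice[t tP] i : exists j,
      [/\ (i <= j)%N, u j (e ^+ 2 * s) < 0 & 0 < u j (e ^+ 2)].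
    have [K _ sqK] := asymptotic_square D Cu.
    apply: contrapT => none; apply: nge; exists (maxn i K) => // j /=.
    rewrite geq_max => /andP[ij /sqK sqj].
    rewrite leNgt; apply/negP => lt0; apply: none; exists j; split=> //.
    rewrite lt_def sqj ?leq_maxl // andbT; apply/eqP => ej0.
    have : u j (e * (e * s)) = 0.
      apply: square_kills => // c; apply: sqj.
      rewrite (leq_trans (msizeD_le _ _)) // geq_max leq_maxl /=.
      by rewrite (leq_trans (msizeZ_le _ _)) // leq_maxr.
    by rewrite mulrA -expr2 => ujs; rewrite ujs ltxx in lt0.
  (* The functionals reweighted by [e ^+ 2]; they kill [H(f)] since [e * H(f)]
     is a multiple of [G(f)]. *)
  pose u' i q := u (t i) (e ^+ 2 * q) / u (t i) (e ^+ 2).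
  have t_oo (P : set nat) :
      (\forall j \near \oo, P j) -> \forall i \near \oo, P (t i).
    move=> [K _ PK]; exists K => // i /= Ki; apply: PK => /=.
    by have [it _ _] := tP i; apply: leq_trans it.
  have e2 i : 0 < u (t i) (e ^+ 2) by have [] := tP i.
  pose C' := C `|` [set poly_at f H; - poly_at f H].
  have C'u' : asymptotic_state C' u'.
    split=> [i p q p'|i|g d C'g].
    - by rewrite /u' (lin_mul2l (ulin _)) mulrDl mulrA.
    - by rewrite /u' mulr1 divff // gt_eqF.
    have szew w : (msize w <= d)%N -> (msize (e * w) <= (msize e + d).+1)%N.
      by move=> wd; apply: msizeM_bound; rewrite ltnW.
    have [_ _ uC] := Cu.
    have nonneg g' : (1 |` C) g' ->
        \forall i \near \oo, forall w, (msize w <= d)%N -> 0 <= u' i (g' * w ^+ 2).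
      move=> /(uC _ (msize e + d).+1)/t_oo; apply: filterS => i h w wd.
      rewrite /u' mulrCA -exprMn; apply: divr_ge0; last exact: ltW.
      by apply: h; apply: szew.
    have kill : \forall i \near \oo, forall w, (msize w <= d)%N ->
        u' i (poly_at f H * w ^+ 2) = 0.
      have /t_oo := uG (msize (poly_at f b * e) + (d + d)).+1.
      apply: filterS => i h w wd; rewrite /u'.
      have -> : e ^+ 2 * (poly_at f H * w ^+ 2)
        = poly_at f G * (poly_at f b * e * w ^+ 2).
        transitivity (e * poly_at f H * (e * w ^+ 2)); first by ring.
        by rewrite eH; ring.
      rewrite h ?mul0r //; apply: msizeM_bound; first exact: leqnSn.
      by rewrite expr2; apply: msizeM_bound; rewrite ltnW.
    case: C'g => [g1|[Cg|[->|->]]];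
      [by apply: nonneg; left|by apply: nonneg; right| |].
      by apply: filterS kill => i h w wd; rewrite h.
    apply: filterS kill => i h w wd.
    have u'lin : lin (u' i).
      by move=> c p q; rewrite /u' (lin_mul2l (ulin _)) mulrDl mulrA.
    by rewrite mulNr (linN u'lin) h // oppr0.
  have [F [L [FF sF u'L C'L]]] := asymptotic_limit (or_introl Cball) C'u'.
  have Ls : L s <= 0.
    apply: cvgr_to_le (u'L s) _; apply: nearW => i; rewrite /u'.
    have [_ lt0 _] := tP i.
    by rewrite -oppr_ge0 -mulNr divr_ge0 ?ltW // oppr_gt0.
  have [x [xC' xs]] := state_point s (or_introl Cball) C'L.
  have fx : f.@[x] = v.
    apply: le_anti; rewrite f_ge ?andbT; last by move=> g Cg; apply: xC'; left.
    by have := le_trans xs Ls; rewrite mevalB mevalC subr_le0.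
  have : (poly_at f H).@[x] = 0.
    apply: le_anti; rewrite xC' ?andbT; last by right; left.
    by rewrite -oppr_ge0 -mevalN xC' //; right; right.
  by rewrite meval_poly_at fx => /eqP; apply/negP.
have Gs := uGq (2%:R * (poly_at f b * poly_at f a) * s).
near=> j.
have Gsj : u j (poly_at f G * (2%:R * (poly_at f b * poly_at f a) * s)) = 0.
  by near: j.
(* The cross term of [(e' + e) ^+ 2 * s] is a multiple of [G(f)]. *)
have sE : s = e' ^+ 2 * s + (e ^+ 2 * s
    + poly_at f G * (2%:R * (poly_at f b * poly_at f a) * s)).
  transitivity ((e' + e) ^+ 2 * s); first by rewrite ee' expr1n mul1r.
  transitivity (e' ^+ 2 * s + (e ^+ 2 * s + 2%:R * e * e' * s)); first by ring.
  by congr (_ + (_ + _)); rewrite eE /e' poly_atM GsE; ring.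
have : 0 <= u j s.
  rewrite sE 2!(linD (ulin j)) Gsj addr0 (_ : u j (e' ^+ 2 * s) = 0).
    by rewrite add0r; near: j.
  by near: j.
rewrite /s (linB (ulin j)) (linC (ulin j)).
by have [_ -> _] := Cu; rewrite mulr1 subr_ge0.
Unshelve. all: by end_near.
Qed.

End LowerBound.

End AsymptoticStates.

(** * Unique minimizers of generic linear costs *)

Section NullSets.
Variables (R : realType) (I : finType) (i0 : I).
Implicit Types (N : set (I -> R)) (a b : I -> R).

Definition volume a b : R := \prod_i (b i - a i).

Lemma volume_ge0 a b : (forall i, a i <= b i) -> 0 <= volume a b.
Proof. by move=> ab; apply: prodr_ge0 => i _; rewrite subr_ge0. Qed.

Lemma lebesgue_outer_ge0 N : (0 <= lebesgue_outer N)%E.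
Proof.
apply: le_ereal_inf_tmp => _ [a [b [ab _ ->]]].
by apply: nneseries_ge0 => j _ _; rewrite lee_fin volume_ge0.
Qed.

Lemma lebesgue_outer_sub0 N N' : N `<=` N' ->
  lebesgue_outer N' = 0%E -> lebesgue_outer N = 0%E.
Proof.
move=> NN' N'0; apply/eqP; rewrite eq_le lebesgue_outer_ge0 andbT -N'0.
apply: ereal_inf_le_tmp => v [a [b [ab N'ab ->]]]; exists a, b; split=> //.
exact: subset_trans N'ab.
Qed.

Lemma ler_sum_uniq (T : eqType) (F : T -> R) (s s' : seq T) :
    (forall t, 0 <= F t) -> uniq s -> {subset s <= s'} ->
  \sum_(t <- s) F t <= \sum_(t <- s') F t.
Proof.
move=> F0; elim: s s' => [|t s IH] s' /=.
  by move=> _ _; rewrite big_nil sumr_ge0.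
move=> /andP[ts us] ss'; have ts' := ss' t (mem_head _ _).
rewrite big_cons (perm_big _ (perm_to_rem ts')) big_cons lerD2l IH // => r rs.
have := ss' r; rewrite inE rs orbT => /(_ isT).
rewrite (perm_mem (perm_to_rem ts')) inE => /predU1P[rt|//].
by rewrite -rt rs in ts.
Qed.

(** Null sets, by covers that may be indexed by any countable type. *)
Definition null_set N : Prop :=
  forall e : R, 0 < e -> exists (T : countType) (a b : T -> I -> R),
    [/\ forall t i, a t i <= b t i, N `<=` \bigcup_t box (a t) (b t)
      & forall s, uniq s -> \sum_(t <- s) volume (a t) (b t) <= e].

Lemma null_set_sequence N (e : R) : null_set N -> 0 < e ->
  exists a b : nat -> I -> R,
    [/\ forall j i, a j i <= b j i, N `<=` \bigcup_j box (a j) (b j)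
      & forall J, \sum_(j <- iota 0 J) volume (a j) (b j) <= e].
Proof.
move=> N0 e0; have [T [a [b [ab Nab sab]]]] := N0 e e0.
pose ext (c : T -> I -> R) j := if pickle_inv j is Some t then c t else fun=> 0.
exists (ext a), (ext b); split=> [j i|x /Nab[t _ xt]|J].
- by rewrite /ext; case: (pickle_inv j) => [t|//]; apply: ab.
- by exists (pickle t) => //; rewrite /ext pickleK_inv.
have -> : \sum_(j <- iota 0 J) volume (ext a j) (ext b j) =
    \sum_(t <- pmap pickle_inv (iota 0 J)) volume (a t) (b t).
  elim: (iota 0 J) => [|j r IH]; first by rewrite !big_nil.
  rewrite big_cons IH /= /ext; case: (pickle_inv j) => [t|] /=.
    by rewrite big_cons.
  by rewrite /volume (bigD1 i0) //= subrr mul0r add0r.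
by apply/sab/(pmap_uniq (@pickle_invK T))/iota_uniq.
Qed.

Lemma null_set_lebesgue N : null_set N -> lebesgue_outer N = 0%E.
Proof.
move=> N0; apply/eqP; rewrite eq_le lebesgue_outer_ge0 andbT.
apply/lee_addgt0Pr => e e0; rewrite add0e.
have [a [b [ab Nab sab]]] := null_set_sequence N0 e0.
apply: le_trans (_ : \sum_(0 <= j <oo) (volume (a j) (b j))%:E <= e%:E)%E.
  by apply: ereal_inf_lbound; exists a, b; split.
apply: lime_le.
  by apply: is_cvg_nneseries => j _ _; rewrite lee_fin volume_ge0.
by apply: nearW => J; rewrite sumEFin lee_fin /index_iota subn0 sab.
Qed.

Lemma sum_half_powers (e : R) (J : nat) : 0 <= e ->
  \sum_(j <- iota 0 J) e / 2 ^+ j.+1 <= e.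
Proof.
move=> e0; suff -> : \sum_(j <- iota 0 J) e / 2 ^+ j.+1 = e - e / 2 ^+ J.
  by rewrite gerBl divr_ge0 // exprn_ge0.
elim: J => [|J IH]; first by rewrite big_nil expr0 divr1 subrr.
rewrite -addn1 iotaD big_cat IH /= big_seq1 add0n addn1 exprS.
have p0 : 2 ^+ J != 0 :> R by rewrite expf_neq0.
by field.
Qed.

Lemma null_set_bigcup (T : countType) (N : T -> set (I -> R)) :
  (forall t, null_set (N t)) -> null_set (\bigcup_t N t).
Proof.
move=> N0 e e0.
have et t : 0 < e / 2 ^+ (pickle (t : T)).+1 by rewrite divr_gt0 // exprn_gt0.
have /choice[a /choice[b abP]] t := null_set_sequence (N0 t) (et t).
exists (T * nat)%type, (fun p => a p.1 p.2), (fun p => b p.1 p.2).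
have ab t j i : a t j i <= b t j i by have [h _ _] := abP t; apply: h.
split=> [//|x [t _ Ntx]|s us].
  by have [_ /(_ x Ntx)[j _ xj] _] := abP t; exists (t, j).
pose ts := undup (map fst s).
pose J := (\max_(j <- map snd s) j).+1.
pose V (p : T * nat) := volume (a p.1 p.2) (b p.1 p.2).
have V0 p : 0 <= V p by apply: volume_ge0.
apply: le_trans (_ : \sum_(p <- [seq (t, j) | t <- ts, j <- iota 0 J]) V p <= e).
  apply: (ler_sum_uniq V0 us) => -[t j] tjs; apply: allpairs_f.
    by rewrite mem_undup; apply/mapP; exists (t, j).
  rewrite mem_iota /= add0n ltnS; apply: leq_bigmax_seq => //.
  by apply/mapP; exists (t, j).
rewrite big_allpairs /=.
apply: le_trans (_ : \sum_(t <- ts) e / 2 ^+ (pickle t).+1 <= e).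
  by apply: ler_sum => t _; have [_ _ sab] := abP t; exact: (sab J).
rewrite -(big_map pickle xpredT (fun k => e / 2 ^+ k.+1)).
apply: le_trans (sum_half_powers (\max_(k <- map pickle ts) k).+1 (ltW e0)).
apply: ler_sum_uniq => [k||k kts].
- by rewrite divr_ge0 ?exprn_ge0 // ltW.
- by rewrite (map_inj_uniq (pcan_inj pickleK_inv)) undup_uniq.
- by rewrite mem_iota /= add0n ltnS; apply: leq_bigmax_seq.
Qed.

Lemma grid_cell (h x : R) (q : nat) : 0 <= x -> x <= h * q.+1%:R ->
  exists c : 'I_q.+1, h * c%:R <= x <= h * (c%:R + 1).
Proof.
elim: q => [|q IH] x0 xq.
  by exists ord0; rewrite /= mulr0 x0 add0r.
have [le|lt] := leP x (h * q.+1%:R).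
  by have [c cP] := IH x0 le; exists (widen_ord (leqnSn _) c).
by exists ord_max; rewrite natr1 ltW.
Qed.

(** A bounded partial Lipschitz graph is null: over each of the [q ^ (d - 1)]
    cells of side [O(1 / q)] it is contained in a box of height [O(1 / q)]. *)
Lemma lipschitz_graph_null N (i : I) (M c : R) : 0 < M -> 0 < c ->
    (forall x j, N x -> `|x j| <= M) ->
    (forall x x', N x -> N x' ->
      c * `|x i - x' i| <= \sum_(j | j != i) `|x j - x' j|) ->
  null_set N.
Proof.
move=> M0 c0 NM Nlip e e0.
pose D : R := #|I|%:R; pose P : R := \prod_(j : I | j != i) (M + M).
have D0 : 0 <= D by [].
have P0 : 0 <= P by apply: prodr_ge0 => j _; rewrite addr_ge0 ?ltW.
(* [P] is the total volume of the cells and the boxes will have height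
   [2 * D * (2 * M / q.+1) / c], so [q] makes their total volume at most [e]. *)
have [q qP] : exists q : nat, 4 * D * M * P / (c * e) < q.+1%:R.
  exists (Num.trunc (4 * D * M * P / (c * e))); exact: truncnS_gt.
pose Q : R := q.+1%:R; have Q0 : 0 < Q by rewrite ltr0n.
pose h := (M + M) / Q; have h0 : 0 < h by rewrite divr_gt0 ?addr_gt0.
pose w := 2 * (D * h / c).
have w0 : 0 <= w.
  by rewrite !mulr_ge0 ?invr_ge0 ?addr_ge0 ?(ltW c0) ?(ltW M0) ?(ltW Q0).
(* Cells are indexed by all the coordinates, and the coordinate [i] of the index
   is pinned to 0 by giving height 0 to the other boxes: the total volume is
   then a product of sums. *)
pose cell (g : {ffun I -> 'I_q.+1}) : set (I -> R) :=
  [set x | N x /\ forall j, j != i ->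
    - M + h * (g j)%:R <= x j <= - M + h * ((g j)%:R + 1)].
have /choice[r rP] g : exists r : I -> R, cell g !=set0 -> cell g r.
  have [[r gr]|ng] := pselect (cell g !=set0); first by exists r.
  by exists (fun=> 0) => /ng.
pose a (g : {ffun I -> 'I_q.+1}) j := if j == i then
  (if g j == ord0 then r g i - w / 2 else 0) else - M + h * (g j)%:R.
pose b (g : {ffun I -> 'I_q.+1}) j := if j == i then
  (if g j == ord0 then r g i + w / 2 else 0) else - M + h * ((g j)%:R + 1).
pose V (j : I) (k : 'I_q.+1) : R :=
  if j == i then (if k == ord0 then w else 0) else h.
have abV g j : b g j - a g j = V j (g j).
  rewrite /a /b /V; case: (j == i); last by ring.
  by case: (g j == ord0); [field|rewrite subrr].
exists {ffun I -> 'I_q.+1}, a, b; split.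
- move=> g j; rewrite -subr_ge0 abV /V.
  by case: (j == i); [case: (g j == ord0)|apply: ltW].
- move=> x Nx.
  have /choice[k kP] j : exists k : 'I_q.+1,
      - M + h * k%:R <= x j <= - M + h * (k%:R + 1).
    have := NM x j Nx; rewrite ler_norml => /andP[xj1 xj2].
    have [||k /andP[k1 k2]] := @grid_cell h (x j + M) q; first by lra.
      by rewrite /h -/Q divfK ?gt_eqF //; lra.
    by exists k; apply/andP; split; lra.
  pose g := [ffun j => if j == i then ord0 else k j].
  have gx : cell g x by split=> // j /negPf ji; rewrite ffunE ji.
  exists g => // j; rewrite /a /b; case: eqP => [->|/eqP ji]; last first.
    by have := kP j; rewrite ffunE (negPf ji).
  rewrite ffunE eqxx eqxx.
  have [Nr rg] := rP g (ex_intro _ x gx).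
  have : `|x i - r g i| <= w / 2.
    rewrite /w mulrC mulKf // ler_pdivlMr // mulrC.
    apply: le_trans (Nlip _ _ Nx Nr) _.
    apply: le_trans (_ : \sum_(j | j != i) h <= _).
      apply: ler_sum => l li; have := rg l li; have := gx.2 l li.
      by rewrite ler_norml => /andP[? ?] /andP[? ?]; apply/andP; split; lra.
    rewrite sumr_const -[h *+ _]mulr_natl ler_wpM2r ?(ltW h0) //.
    by rewrite ler_nat max_card.
  by rewrite ler_norml => /andP[? ?]; apply/andP; split; lra.
move=> s us.
apply: le_trans (_ : \sum_(g : {ffun I -> 'I_q.+1}) volume (a g) (b g) <= e).
  rewrite -big_enum; apply: ler_sum_uniq => // [g|g _]; last by rewrite mem_enum.
  apply: volume_ge0 => j; rewrite -subr_ge0 abV /V.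
  by case: (j == i); [case: (g j == ord0)|apply: ltW].
have -> : \sum_(g : {ffun I -> 'I_q.+1}) volume (a g) (b g)
    = \prod_j \sum_k V j k.
  rewrite bigA_distr_bigA; apply: eq_bigr => g _; apply: eq_bigr => j _.
  exact: abV.
rewrite (bigD1 i) //= (bigD1 ord0) //= big1 => [|k /negPf k0]; last first.
  by rewrite /V eqxx k0.
have -> : \prod_(j | j != i) \sum_k V j k = P.
  apply: eq_bigr => j /negPf ji; rewrite /V ji.
  rewrite sumr_const card_ord -mulr_natr /h -/Q divfK // gt_eqF //.
rewrite /V !eqxx addr0 /w /h.
move: qP; rewrite -/Q ltr_pdivrMr ?mulr_gt0 // => /ltW qP.
have -> : 2 * (D * ((M + M) / Q) / c) * P = 4 * D * M * P / (Q * c).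
  by field; rewrite !gt_eqF.
rewrite ler_pdivrMr ?mulr_gt0 //.
by rewrite (_ : e * (Q * c) = Q * (c * e)) //; ring.
Qed.


End NullSets.

Section UniqueMinimizers.
Variables (R : realType) (I : finType) (X : Type) (K : set X) (phi : X -> I -> R).
Hypothesis phi_le1 : forall x i, K x -> `|phi x i| <= 1.

Definition lincost (xi : I -> R) (x : X) : R := \sum_i xi i * phi x i.

(** Parameters with two minimizers that are separated by the gap [a < b] in
    the coordinate [i].  Monotonicity of the minimizers in the direction of [i]
    makes this set a partial Lipschitz graph over the other coordinates. *)
Definition gap_set (i : I) (a b M : R) : set (I -> R) :=
  [set xi | [/\ a < b, forall j, `|xi j| <= M,
     exists x, optimizer K (lincost xi) x /\ phi x i <= a
   & exists x, optimizer K (lincost xi) x /\ b <= phi x i]].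

Lemma gap_set_half_lipschitz i a b M xi xi' :
    gap_set i a b M xi -> gap_set i a b M xi' ->
  (b - a) * (xi' i - xi i) <= 2 * \sum_(j | j != i) `|xi j - xi' j|.
Proof.
move=> [ab _ [x [[Kx xmin] xa]] _] [_ _ _ [z [[Kz zmin] zb]]].
have [le|lt] := leP (xi' i) (xi i).
  apply: le_trans (_ : 0 <= _); first by nra.
  by rewrite mulr_ge0 // sumr_ge0.
have h1 := xmin z Kz; have h2 := zmin x Kx.
have h : (xi' i - xi i) * (phi z i - phi x i)
    <= \sum_(j | j != i) (xi j - xi' j) * (phi z j - phi x j).
  have : \sum_j (xi' j - xi j) * (phi z j - phi x j) <= 0.
    have -> : \sum_j (xi' j - xi j) * (phi z j - phi x j)
       = (lincost xi' z - lincost xi' x) - (lincost xi z - lincost xi x).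
      by rewrite /lincost -!sumrB; apply: eq_bigr => j _; ring.
    lra.
  rewrite (bigD1 i) //= -lerBrDr sub0r => h; apply: le_trans h _.
  by rewrite -sumrN; apply/ler_sum => j _; rewrite -mulNr opprB.
apply: le_trans (_ : (xi' i - xi i) * (phi z i - phi x i) <= _); first by nra.
apply: le_trans h _; rewrite mulr_sumr; apply: ler_sum => j _.
apply: le_trans (ler_norm _) _; rewrite normrM mulrC ler_wpM2r //.
have := phi_le1 j Kx; have := phi_le1 j Kz; rewrite !ler_norml.
by move=> /andP[? ?] /andP[? ?]; apply/andP; split; lra.
Qed.

Lemma gap_set_null (i : I) a b M : null_set (gap_set i a b M).
Proof.
have [ab|ba] := ltP a b; last first.
  move=> e e0; exists void, (@of_void _), (@of_void _).
  split=> [[]|xi [ab]|s _]; first by rewrite ltNge ba in ab.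
  by case: s => [|[]]; rewrite big_nil ltW.
apply: (@lipschitz_graph_null R I _ i (`|M| + 1) ((b - a) / 2)).
- by rewrite ltr_wpDl.
- by rewrite divr_gt0 // subr_gt0.
- move=> xi j [_ xiM _ _]; apply: le_trans (xiM j) _.
  by rewrite (le_trans (ler_norm M)) // lerDl.
move=> xi xi' h h'; rewrite mulrAC ler_pdivrMr // [leRHS]mulrC.
have [le|lt] := leP (xi i) (xi' i).
  rewrite distrC ger0_norm ?subr_ge0 //; exact: gap_set_half_lipschitz h h'.
rewrite gtr0_norm ?subr_gt0 //.
under eq_bigr do rewrite distrC.
exact: gap_set_half_lipschitz h' h.
Qed.

(** Minimizers that differ in some coordinate are separated there by a rational
    gap, so the exceptional costs lie in countably many gap sets. *)
Lemma almost_all_unique_minimizer (i0 : I) :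
  almost_all (fun xi : I -> R => forall x x',
    optimizer K (lincost xi) x -> optimizer K (lincost xi) x' ->
    forall i, phi x i = phi x' i).
Proof.
pose T := (I * rat * rat * nat)%type.
pose N (t : T) := gap_set t.1.1.1 (ratr t.1.1.2) (ratr t.1.2) t.2%:R.
apply: (@lebesgue_outer_sub0 _ _ _ (\bigcup_t N t)); last first.
  apply: (null_set_lebesgue i0); apply: (null_set_bigcup i0) => t.
  exact: gap_set_null.
move=> xi /= nuniq; apply: contrapT => notN; apply: nuniq => x x' xmin x'min i.
have [M xiM] : exists M : nat, forall j, `|xi j| <= M%:R.
  exists (Num.trunc (\sum_j `|xi j|)).+1 => j.
  apply/ltW/(le_lt_trans _ (truncnS_gt _)).
  by rewrite (bigD1 j) //= lerDl sumr_ge0.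
wlog lt : x x' xmin x'min / phi x i < phi x' i.
  move=> wl; have [lt|lt|//] := ltgtP (phi x i) (phi x' i); first exact: wl.
  by apply/esym/wl.
have [a] := rat_in_itvoo lt; rewrite in_itv /= => /andP[xa ax'].
have [b] := rat_in_itvoo ax'; rewrite in_itv /= => /andP[ab bx'].
case: notN; exists (i, a, b, M) => //; split=> //=.
- by exists x; split; rewrite ?ltW.
- by exists x'; split; rewrite ?ltW.
Qed.

End UniqueMinimizers.


(** * Minimizers over the simplex *)

Section Simplex.
Variables (R : realType) (n : nat).
Implicit Types (q f : {mpoly R[n]}) (x y d : 'I_n -> R).

Lemma meval_cvg q (F : set_system nat) (u : nat -> 'I_n -> R) y : ProperFilter F ->
    (forall i, u k i @[k --> F] --> y i) ->
  q.@[u k] @[k --> F] --> q.@[y].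
Proof.
move=> FF uy; elim/mpoly_ring_ind: q => [c|i|p q IHp IHq|p q IHp IHq].
- rewrite mevalC; under eq_fun do rewrite mevalC; exact: cvg_cst.
- rewrite mevalXU; under eq_fun do rewrite mevalXU; exact: uy.
- by rewrite mevalD; under eq_fun do rewrite mevalD; apply: cvgD.
- by rewrite mevalM; under eq_fun do rewrite mevalM; apply: cvgM.
Qed.

Lemma simplex_le1 x i : simplex x -> 0 <= x i <= 1.
Proof.
move=> [<- x0]; rewrite x0 /= (bigD1 i) //= lerDl.
by apply: sumr_ge0 => j _; apply: x0.
Qed.

Lemma simplex_ball x : simplex x -> 0 <= (ballpoly R n).@[x].
Proof.
move=> Sx; rewrite /ballpoly mevalB meval1 subr_ge0 raddf_sum /=.
have [<- x0] := Sx; apply: ler_sum => i _.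
rewrite rmorphXn /= mevalXU expr2; have /andP[_ xi1] := simplex_le1 i Sx.
by rewrite ler_piMr.
Qed.

Lemma meval_sumpoly x : (sumpoly R n).@[x] = \sum_i x i - 1.
Proof.
rewrite /sumpoly mevalB meval1 raddf_sum /=; congr (_ - _).
by apply: eq_bigr => i _; rewrite mevalXU.
Qed.

(** Used with [g = 0] for the simplex itself and with [g = f] for the set of
    minimizers of [f]. *)
Lemma simplex_minimizer f g (v : R) :
    (exists x, simplex x /\ g.@[x] <= v) ->
  exists x, optimizer [set x | simplex x /\ g.@[x] <= v] (fun x => f.@[x]) x.
Proof.
set S := [set x | _] => Sx0.
have le1 y i : S y -> `|y i| <= 1.
  by move=> [/(simplex_le1 i)/andP[y0 y1] _]; rewrite ger0_norm.
apply: (attain_min Sx0) => [i||F FF u y Su uy].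
- by exists 1 => y; apply: le1.
- exists (- norm1 f) => y Sy; rewrite lerNl (le_trans (ler_norm _)) // normrN.
  apply: (lin_le_norm1 (L := meval y)) => [a p q|a _].
    by rewrite mevalD mevalZ.
  rewrite mevalX normr_prod; apply: prodr_ile1 => i _.
  by rewrite normrX exprn_ge0 //= exprn_ile1 ?le1.
have gy : g.@[y] <= v.
  apply: (cvgr_to_le (meval_cvg (q := g) FF uy)).
  by apply: nearW => k; case: (Su k).
have y0 i : 0 <= y i.
  apply: (cvgr_to_ge (uy i)); apply: nearW => k.
  by have [[_ ->]] := Su k.
split; last exact: meval_cvg.
do 2!split=> //.
have sum_cvg : \sum_i u k i @[k --> F] --> \sum_i y i by apply: cvg_bigsum.
apply: (cvg_unique _ sum_cvg); first exact: Rhausdorff.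
have -> : (fun k => \sum_i u k i) = (fun=> 1).
  by apply/funext => k; have [[]] := Su k.
exact: cvg_cst.
Qed.

Lemma simplex_vertex (i : 'I_n) : simplex (fun j => (j == i)%:R : R).
Proof.
split=> [|j]; last by [].
by rewrite (bigD1 i) //= eqxx big1 ?addr0 // => j /negPf->.
Qed.

Lemma taylor_line q x d : exists r : {poly R}, forall t,
  q.@[fun i => x i + t * d i]
    = q.@[x] + t * (\sum_j q^`M(j).@[x] * d j) + t ^+ 2 * r.[t].
Proof.
elim/mpoly_ring_ind: q => [c|i|p q [r rP] [s sP]|p q [r rP] [s sP]].
- exists 0 => t; rewrite !mevalC horner0 mulr0 addr0 big1 ?mulr0 ?addr0 // => j _.
  by rewrite mderivC meval0 mul0r.
- exists 0 => t; rewrite !mevalXU horner0 mulr0 addr0 (bigD1 i) //= big1.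
    by rewrite mderivXU eqxx meval1 mul1r addr0.
  by move=> j /negPf ji; rewrite mderivXU ji meval0 mul0r.
- exists (r + s) => t; rewrite !mevalD rP sP hornerD.
  under [in RHS]eq_bigr do rewrite mderivD mevalD mulrDl.
  by rewrite big_split /=; ring.
set a := \sum_j p^`M(j).@[x] * d j in rP *.
set b := \sum_j q^`M(j).@[x] * d j in sP *.
exists ((a * b)%:P + (p.@[x])%:P * s + (q.@[x])%:P * r + 'X * (a%:P * s + b%:P * r)
  + 'X ^+ 2 * r * s) => t.
rewrite !mevalM rP sP !(hornerD, hornerM, hornerX, hornerC, hornerXn).
have -> : \sum_j (p * q)^`M(j).@[x] * d j = a * q.@[x] + p.@[x] * b.
  rewrite /a /b mulr_suml mulr_sumr -big_split; apply: eq_bigr => j _ /=.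
  by rewrite mderivM mevalD !mevalM; ring.
by ring.
Qed.

Lemma first_order_ge0 (a : R) (r : {poly R}) :
  (forall t, 0 <= t <= 1 -> 0 <= t * a + t ^+ 2 * r.[t]) -> 0 <= a.
Proof.
move=> h; rewrite leNgt; apply/negP => a0.
pose B := \sum_(i < size r) `|r`_i|; have B0 : 0 <= B by apply: sumr_ge0.
have rB t : 0 <= t <= 1 -> r.[t] <= B.
  move=> /andP[t0 t1]; rewrite horner_coef; apply: ler_sum => i _.
  apply: le_trans (ler_norm _) _; rewrite normrM ler_piMr // normrX.
  by rewrite exprn_ile1 // ger0_norm.
(* The negative linear term beats the quadratic term bounded by [t ^+ 2 * B]. *)
pose t := - a / (B + 1 - a); have d0 : 0 < B + 1 - a by lra.
have t0 : 0 < t by rewrite divr_gt0 // oppr_gt0.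
have t1 : t <= 1 by rewrite /t ler_pdivrMr // mul1r; lra.
have t01 : 0 <= t <= 1 by rewrite ltW.
have aE : - a = t * (B + 1 - a) by rewrite /t divfK // gt_eqF.
have h1 := h t t01; have h2 := rB t t01.
have : 0 <= t * (a + t * B).
  by apply: le_trans h1 _; rewrite mulrDr lerD2l mulrA -expr2 ler_wpM2l // sqr_ge0.
by rewrite pmulr_rge0 // => h3; nra.
Qed.

End Simplex.

Section TensorForm.
Variables (R : realType) (m n : nat) (A : tensor R m n).

Definition exponent (t : m.-tuple 'I_n) : 'X_{1..n} :=
  (\sum_(j < m) U_(tnth t j))%MM.

Lemma mdeg_exponent t : mdeg (exponent t) = m.
Proof.
rewrite /exponent mdeg_sum; under eq_bigr do rewrite mdeg1.
by rewrite sum1_card card_ord.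
Qed.

Lemma tformE : tform A = \sum_t A t *: 'X_[exponent t].
Proof. by apply: eq_bigr => t _; rewrite /exponent mprodXE. Qed.

Lemma meval_tform x : (tform A).@[x] = \sum_t A t * \prod_(j < m) x (tnth t j).
Proof.
rewrite /tform raddf_sum; apply: eq_bigr => t _ /=.
rewrite mevalZ rmorph_prod /=; congr (_ * _); apply: eq_bigr => j _.
by rewrite mevalXU.
Qed.

Lemma tform_homog c x :
  (tform A).@[fun i => c * x i] = c ^+ m * (tform A).@[x].
Proof.
rewrite !meval_tform mulr_sumr; apply: eq_bigr => t _.
rewrite big_split /= prodr_const card_ord; ring.
Qed.

Lemma euler_tform : \sum_i 'X_i * (tform A)^`M(i) = m%:R *: tform A.
Proof.
have eulerX (a : 'X_{1..n}) :
    \sum_i 'X_i * ('X_[a])^`M(i) = (mdeg a)%:R *: 'X_[a] :> {mpoly R[n]}.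
  rewrite mdegE natr_sum scaler_suml; apply: eq_bigr => i _.
  rewrite mderivX -scalerAr.
  have [->|ai] := eqVneq (a i) 0%N; first by rewrite !scale0r.
  by rewrite -mpolyXD addmC submK // lep1mP.
rewrite tformE.
under eq_bigr do rewrite raddf_sum mulr_sumr.
rewrite exchange_big scaler_sumr; apply: eq_bigr => t _ /=.
under eq_bigr do rewrite mderivZ -scalerAr.
by rewrite -scaler_sumr eulerX mdeg_exponent scalerA mulrC -scalerA.
Qed.

Lemma msize_tform : (msize (tform A) <= m.+1)%N.
Proof.
rewrite tformE (leq_trans (msize_sum _ _ _)) //; apply/bigmax_leqP => t _.
by rewrite (leq_trans (msizeZ_le _ _)) // msizeX mdeg_exponent.
Qed.

Lemma meval_critpoly x i :
  (critpoly A i).@[x] = (tform A)^`M(i).@[x] - m%:R * (tform A).@[x].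
Proof. by rewrite /critpoly mevalB mevalZ. Qed.

(** The [critpoly A i] at a minimizer over the simplex are the Lagrange
    multipliers of the constraints [0 <= x i]. *)
Lemma minimizer_kkt x : optimizer (@simplex R n) (fun x => (tform A).@[x]) x ->
  forall i, 0 <= (critpoly A i).@[x] /\ x i * (critpoly A i).@[x] = 0.
Proof.
move=> [Sx xmin]; have [sx x0] := Sx.
have euler : \sum_i x i * (tform A)^`M(i).@[x] = m%:R * (tform A).@[x].
  have /(congr1 (meval x)) := euler_tform.
  rewrite raddf_sum mevalZ => <-; apply: eq_bigr => i _ /=.
  by rewrite mevalM mevalXU.
have crit0 i : 0 <= (critpoly A i).@[x].
  have [r rP] := taylor_line (tform A) x (fun j => (j == i)%:R - x j).
  have aE : \sum_j (tform A)^`M(j).@[x] * ((j == i)%:R - x j) = (critpoly A i).@[x].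
    rewrite meval_critpoly -euler.
    under eq_bigr do rewrite mulrBr.
    rewrite sumrB; congr (_ - _); last by apply: eq_bigr => j _; rewrite mulrC.
    rewrite (bigD1 i) //= eqxx mulr1 big1 ?addr0 // => j /negPf->.
    by rewrite mulr0.
  apply: (first_order_ge0 (r := r)) => t /andP[t0 t1].
  have := xmin (fun j => x j + t * ((j == i)%:R - x j)).
  rewrite rP aE -addrA lerDl; apply; split=> [|j].
    have [si _] := @simplex_vertex R n i.
    by rewrite big_split /= -mulr_sumr sumrB si sx subrr mulr0 addr0.
  rewrite (_ : _ + _ = (1 - t) * x j + t * (j == i)%:R); last by ring.
  by rewrite addr_ge0 // mulr_ge0 // subr_ge0.
move=> i; split=> //; apply/eqP.
have : \sum_i x i * (critpoly A i).@[x] = 0.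
  under eq_bigr do rewrite meval_critpoly mulrBr.
  by rewrite sumrB euler -mulr_suml sx mul1r subrr.
move/eqP; rewrite psumr_eq0 => [/allP/(_ i)|j _]; last exact: mulr_ge0.
by rewrite mem_index_enum => /(_ isT).
Qed.

End TensorForm.

(** * The two programs and the algorithm *)

Lemma optval_optimizer (R : realType) (T : Type) (S : set T) (f : T -> R) z :
  optimizer S f z -> optval S f = f z.
Proof.
move=> [Sz zmin]; apply/eqP; rewrite eq_le /optval; apply/andP; split.
  by apply: ge_inf; [exists (f z) => _ [y Sy <-]; apply: zmin|exists z].
by apply: lb_le_inf; [exists (f z), z|move=> _ [y Sy <-]; apply: zmin].
Qed.

Section Programs.
Variables (R : realType) (m n : nat) (A : tensor R m n).
Hypotheses (m_gt0 : (0 < m)%N) (n_gt0 : (0 < n)%N).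

Local Notation f := (tform A).
Local Notation P := {mpoly R[n]}.

Definition eqP_polys : set P :=
  [set sumpoly R n] `|` range (fun i => 'X_i * critpoly A i).
Definition geP_polys : set P :=
  [set ballpoly R n] `|` range (fun i => 'X_i) `|` range (critpoly A).

Definition eqQ_polys : set P := [set sumpoly R n].
Definition geQ_polys (v : R) : set P :=
  [set ballpoly R n] `|` range (fun i => 'X_i) `|` [set v%:MP - f].

Lemma feasPE k : feasP A k = @moment_feasible R n eqP_polys geP_polys k.
Proof.
apply/seteqP; split=> y.
  move=> [h1 [h2 [h3 [h4 [h5 [h6 h7]]]]]]; split=> //.
    by move=> h [->//|[i _ <-]].
  by move=> g [[->//|[i _ <-]]|[i _ <-]].
move=> [h1 h2 h3 h4].
split; [|split; [|split; [|split; [|split; [|split=> //]]]]].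
- by apply: h1; left.
- by move=> i; apply: h1; right; exists i.
- by apply: h2; left; left.
- by move=> i; apply: h2; left; right; exists i.
- by move=> i; apply: h2; right; exists i.
Qed.

Lemma feasQE k :
  feasQ A k = @moment_feasible R n eqQ_polys (geQ_polys (vmom A k)) k.
Proof.
apply/seteqP; split=> y.
  move=> [h1 [h2 [h3 [h4 [h5 h6]]]]]; split=> //.
    by move=> h ->.
  by move=> g [[->//|[i _ <-]]|->].
move=> [h1 h2 h3 h4].
split; [|split; [|split; [|split; [|split=> //]]]].
- by apply: h1.
- by move=> i; apply: h2; left; right; exists i.
- by apply: h2; left; left.
- by apply: h2; right.
Qed.

Lemma geP_ball : geP_polys (ballpoly R n). Proof. by left; left. Qed.
Lemma geQ_ball v : geQ_polys v (ballpoly R n). Proof. by left; left. Qed.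

Lemma order_gt0 k : (uphalf m <= k)%N -> (0 < k)%N.
Proof. by apply: leq_trans; rewrite uphalf_gt0. Qed.

Lemma degree_le k p : (uphalf m <= k)%N -> (msize p <= m.+1)%N ->
  (msize (p : P) <= k.*2.+1)%N.
Proof. by rewrite leq_uphalf_double => mk pm; rewrite (leq_trans pm). Qed.

Lemma simplex_min : exists2 x, simplex x &
  f.@[x] = vstar A /\ optimizer (@simplex R n) (fun x => f.@[x]) x.
Proof.
have [x [[Sx _] xmin]] : exists x,
    optimizer [set x | simplex x /\ (0 : P).@[x] <= 0] (fun x => f.@[x]) x.
  apply: simplex_minimizer; exists (fun j => (j == Ordinal n_gt0)%:R).
  by rewrite meval0; split=> //; apply: simplex_vertex.
have xopt : optimizer (@simplex R n) (fun x => f.@[x]) x.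
  by split=> // z Sz; apply: xmin; rewrite /= meval0.
by exists x => //; split=> //; rewrite /vstar (optval_optimizer xopt).
Qed.

Lemma vstar_le x : simplex x -> vstar A <= f.@[x].
Proof. by move=> Sx; have [z _ [<- [_ zmin]]] := simplex_min; apply: zmin. Qed.

Lemma feasP_minimizer k x : optimizer (@simplex R n) (fun x => f.@[x]) x ->
  feasP A k (@point_moments R n k.*2 x).
Proof.
move=> xopt; have [[sx x0] _] := xopt; have kkt := minimizer_kkt xopt.
rewrite feasPE; apply: moment_feasible_point.
  move=> h [->|[i _ <-]]; first by rewrite meval_sumpoly sx subrr.
  by rewrite mevalM mevalXU; have [] := kkt i.
move=> g [[->|[i _ <-]]|[i _ <-]].
- by apply: simplex_ball.
- by rewrite mevalXU.
- by have [] := kkt i.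
Qed.

Lemma feasP_neq0 k : feasP A k !=set0.
Proof.
have [x _ [_ xopt]] := simplex_min.
by exists (@point_moments R n k.*2 x); apply: feasP_minimizer.
Qed.

Lemma feasP_optimizer k : exists y, optimizer (feasP A k) (costP A) y.
Proof.
have := feasP_neq0 k; rewrite feasPE => F0.
exact: moment_feasible_optimizer geP_ball F0.
Qed.

Lemma feasQ_optimizer (xi : momvec R n m) k : feasQ A k !=set0 ->
  exists y, optimizer (feasQ A k) (costQ xi) y.
Proof.
rewrite feasQE => F0; exact: moment_feasible_optimizer (geQ_ball _) F0.
Qed.

Lemma vmom_le_vstar k : (uphalf m <= k)%N -> vmom A k <= vstar A.
Proof.
move=> mk; have [x _ [<- xopt]] := simplex_min.
have [y yopt] := feasP_optimizer k.
rewrite /vmom (optval_optimizer yopt).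
rewrite -(@pairing_point R n k.*2 x); last first.
  by apply: degree_le => //; apply: msize_tform.
by have [_] := yopt; apply; apply: feasP_minimizer.
Qed.

Lemma both_signs_zero (C E : set P) (x : 'I_n -> R) h : E h ->
  (forall g, both_signs C E g -> 0 <= g.@[x]) -> h.@[x] = 0.
Proof.
move=> Eh xC; apply: le_anti; rewrite xC ?andbT; last by left; right.
by rewrite -oppr_ge0 -mevalN xC //; right; rewrite /= opprK.
Qed.

Lemma simplex_from_signs (C E : set P) (x : 'I_n -> R) :
    E (sumpoly R n) -> (forall i, C 'X_i) ->
    (forall g, both_signs C E g -> 0 <= g.@[x]) -> simplex x.
Proof.
move=> Es CX xC; split=> [|i].
  by have /eqP := both_signs_zero Es xC; rewrite meval_sumpoly subr_eq0 => /eqP.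
by rewrite -(mevalXU x i); apply: xC; left; left.
Qed.

(** Were [v_k < v] for infinitely many orders, optimizers of these orders would
    form an asymptotic state, which kills [G(f)] and contradicts the lower
    bound. *)
Lemma vmom_eq_vstar : exists K, forall k, (uphalf m <= k)%N -> (K <= k)%N ->
  vmom A k = vstar A.
Proof.
apply: contrapT => none.
have /choice[ky kyP] j : exists ky : {k : nat & momvec R n k.*2},
    [/\ (j <= projT1 ky)%N, (uphalf m <= projT1 ky)%N,
        moment_feasible eqP_polys geP_polys (projT2 ky)
      & pairing f (projT2 ky) < vstar A].
  apply: contrapT => nj; apply: none; exists j => k mk jk.
  have [y yopt] := feasP_optimizer k.
  have vE : vmom A k = pairing f y by rewrite /vmom (optval_optimizer yopt).
  apply: le_anti; rewrite vmom_le_vstar //= leNgt; apply/negP => lt.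
  apply: nj; exists (existT _ k y); split=> //=; last by rewrite -vE.
  by rewrite -feasPE; case: yopt.
pose k j := projT1 (ky j); pose y j : momvec R n (k j).*2 := projT2 (ky j).
have jk j : (j <= k j)%N by case: (kyP j).
have yF j : moment_feasible eqP_polys geP_polys (y j) by case: (kyP j).
pose u j (p : P) := pairing p (y j).
have Cu := feasible_asymptotic jk yF.
have ulin j : lin (u j) by apply: pairing_lin.
pose killed (h : P) := forall d, \forall j \near \oo, forall q : P,
  (msize q <= d)%N -> u j (h * q) = 0.
have killedD h h' : killed h -> killed h' -> killed (h + h').
  move=> kh kh' d; apply: filterS2 (kh d) (kh' d) => j hj h'j q qd.
  by rewrite mulrDl (linD (ulin j)) hj // h'j // addr0.
have killedM c h : eqP_polys h -> killed (c * h).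
  move=> Eh d.
  have := @feasible_asymptotic_zero R n _ _ k y h (msize c + d).+1 jk yF Eh.
  apply: filterS => j hj q qd; rewrite [c * h]mulrC -mulrA; apply: hj.
  by apply: msizeM_bound; rewrite ltnW.
have killed0 : killed 0.
  by move=> d; apply: nearW => j q _; rewrite mul0r (lin0 (ulin j)).
have R_char0 : [pchar R] =i pred0 := pchar_num R.
have [G G0 [c0 [c GE]]] := kkt_values_algebraic R_char0 f (m%:R *: f).
have uG : killed (poly_at f G).
  rewrite GE; apply: (killedD); first by apply: (killedM); left.
  apply: (big_ind killed) => [||i _]; [exact: killed0|exact: killedD|].
  by apply: (killedM); right; exists i.
have f_ge x : (forall g, both_signs geP_polys eqP_polys g -> 0 <= g.@[x]) ->
    vstar A <= f.@[x].
  move=> xC; apply: vstar_le; apply: (simplex_from_signs _ _ xC).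
    by left.
  by move=> i; left; right; exists i.
have ball : both_signs geP_polys eqP_polys (ballpoly R n).
  by left; left; exact: geP_ball.
have [K _ /(_ K (leqnn K))] := asymptotic_lower_bound ball Cu G0 uG f_ge.
by rewrite leNgt; apply/negP/negPn; case: (kyP K).
Qed.

Lemma first_moments_simplex k (y : momvec R n k.*2) : (uphalf m <= k)%N ->
  feasQ A k y -> simplex (first_moments y).
Proof.
move=> /order_gt0 k0; rewrite feasQE => yF.
have yl := pairing_lin y.
split=> [|i].
  have : pairing (sumpoly R n * 1) y = 0.
    have hs : (halfdeg (sumpoly R n) <= k)%N.
      apply: leq_trans k0; apply: halfdeg_le.
      rewrite (leq_trans (msizeD_le _ _)) // geq_max msizeN msize1 andbT.
      rewrite (leq_trans (msize_sum _ _ _)) //.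
      by apply/bigmax_leqP => i _; rewrite msizeX mdeg1.
    by apply: (feasible_zero yF) => //; rewrite msize1.
  rewrite mulr1 /sumpoly (linB yl) (lin_sum yl) (feasible_pairing1 yF) => /eqP.
  by rewrite subr_eq0 => /eqP.
have hX : (halfdeg ('X_i : P) <= k)%N.
  by apply: leq_trans k0; apply: halfdeg_le; rewrite msizeX mdeg1.
have := feasible_psd yF (w := 1) (or_introl (or_intror (imageT _ i))) hX.
by rewrite expr1n mulr1 msize1; apply.
Qed.

Section Algorithm.
Variable xi : momvec R n m.

(** The second program has an optimizer whenever it is feasible, so executions
    never get stuck; they end once one of the two tests is bound to succeed
    whatever optimizer is chosen. *)
Lemma algorithm_ends (Q : state R n -> Prop) (K : nat) :
    (forall k, (uphalf m <= k)%N -> 0 <= vmom A k ->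
      Q (DeclaredCopositive R n k)) ->
    (forall k (y : momvec R n k.*2), (uphalf m <= k)%N -> feasQ A k y ->
      f.@[first_moments y] < 0 -> Q (DeclaredNotCopositive k (first_moments y))) ->
    (forall k, (uphalf m <= k)%N -> (K <= k)%N -> vmom A k < 0 ->
      feasQ A k !=set0 /\ forall y, optimizer (feasQ A k) (costQ xi) y ->
        f.@[first_moments y] < 0) ->
  algorithm_must_end A xi Q.
Proof.
move=> Qcop Qnot QK; rewrite /algorithm_must_end.
suff reach d k : (uphalf m <= k)%N -> (K <= k + d)%N ->
    must_reach A xi Q (Step1 R n k).
  by apply: (reach K); rewrite // leq_addl.
elim: d k => [|d IH] k mk Kk.
  apply: Continue => [|s' /= ->]; first by eexists.
  have [v0|v0] := leP 0 (vmom A k); first by apply/Reached/Qcop.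
  rewrite addn0 in Kk; have [Fk opt_lt0] := QK k mk Kk v0.
  apply: Continue => [|s2 /= [[y yopt ->]|[F0 _]]].
  - have [y yopt] := feasQ_optimizer xi Fk.
    by exists (Step3 y); left; exists y.
  - apply: Continue => [|s3 /= ->]; first by eexists.
    rewrite opt_lt0 //; apply: Reached; apply: Qnot => //; last exact: opt_lt0.
    by case: yopt.
  - by move/set0P: Fk; rewrite F0 eqxx.
have next : must_reach A xi Q (Step1 R n k.+1).
  by apply: IH; [exact: leqW|rewrite addSnnS].
apply: Continue => [|s' /= ->]; first by eexists.
have [v0|v0] := leP 0 (vmom A k); first by apply/Reached/Qcop.
apply: Continue => [|s2 /= [[y yopt ->]|[_ ->//]]].
  have [F0|/set0P Fk] := eqVneq (feasQ A k) set0.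
    by exists (Step1 R n k.+1); right.
  have [y yopt] := feasQ_optimizer xi Fk.
  by exists (Step3 y); left; exists y.
apply: Continue => [|s3 /= ->]; first by eexists.
case: ifPn => // lt0; apply: Reached; apply: Qnot => //.
by case: yopt.
Qed.

End Algorithm.

Definition minimizers_region : set ('I_n -> R) :=
  [set x | simplex x /\ f.@[x] <= vstar A].

Definition monomial_values (x : 'I_n -> R) (a : 'X_{1..n < m.+1}) : R :=
  'X_[R, bmnm a].@[x].

Lemma lincostE xi x : lincost monomial_values xi x = (polyof xi).@[x].
Proof. by rewrite /polyof raddf_sum; apply: eq_bigr => a _; rewrite /= mevalZ. Qed.

Lemma monomial_values_le1 x a : minimizers_region x -> `|monomial_values x a| <= 1.
Proof.
move=> [Sx _]; rewrite /monomial_values mevalX normr_prod.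
apply: prodr_ile1 => i _; have /andP[x0 x1] := simplex_le1 i Sx.
by rewrite normrX exprn_ge0 //= exprn_ile1 ?ger0_norm.
Qed.

Definition unique_minimizer (xi : momvec R n m) : Prop := forall x x',
  optimizer minimizers_region (lincost monomial_values xi) x ->
  optimizer minimizers_region (lincost monomial_values xi) x' ->
  forall i, x i = x' i.

Lemma almost_all_unique (Q : momvec R n m -> Prop) :
  (forall xi, unique_minimizer xi -> Q xi) -> almost_all Q.
Proof.
move=> uQ; apply: lebesgue_outer_sub0
  (almost_all_unique_minimizer monomial_values_le1 (bm0 : 'X_{1..n < m.+1})).
move=> xi /= nQ uxi; apply/nQ/uQ => x x' xmin x'min i.
have Ui : (mdeg U_(i)%MM < m.+1)%N by rewrite mdeg1.
have := uxi x x' xmin x'min (BMultinom Ui).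
by rewrite /monomial_values /= !mevalXU.
Qed.

Lemma geQ_point v (x : 'I_n -> R) :
    (forall g, both_signs (geQ_polys v) eqQ_polys g -> 0 <= g.@[x]) ->
  simplex x /\ f.@[x] <= v.
Proof.
move=> xC; split.
  by apply: (simplex_from_signs _ _ xC) => // i; left; right; exists i.
have /xC : both_signs (geQ_polys v) eqQ_polys (v%:MP - f) by left; left; right.
by rewrite mevalB mevalC subr_ge0.
Qed.

(** Limits of optimizers of the second program are states of minimal cost.
    Such a state gives the cost a definite value, so the points extracted from
    it all equal the unique minimizer, which pins down its first moments from
    both sides. *)
Lemma optimizers_eventually_negative (xi : momvec R n m) :
    unique_minimizer xi -> vstar A < 0 ->
  exists K, forall k, (uphalf m <= k)%N -> (K <= k)%N ->
    feasQ A k !=set0 /\ forall y, optimizer (feasQ A k) (costQ xi) y ->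
      f.@[first_moments y] < 0.
Proof.
move=> uniq_xi v0; have [K0 vE] := vmom_eq_vstar.
have [x0 Sx0 [fx0 _]] := simplex_min.
have [xs xsmin] : exists x,
    optimizer minimizers_region (fun x => (polyof xi).@[x]) x.
  by apply: simplex_minimizer; exists x0; rewrite fx0.
have [[Sxs fxs] xsle] := xsmin.
have point_feas k : (uphalf m <= k)%N -> (K0 <= k)%N ->
    feasQ A k (@point_moments R n k.*2 xs).
  move=> mk Kk; rewrite feasQE vE //; apply: moment_feasible_point.
    by move=> h ->; rewrite meval_sumpoly; case: Sxs => -> _; rewrite subrr.
  move=> g [[->|[i _ <-]]|->].
  - exact: simplex_ball.
  - by rewrite mevalXU; case: Sxs.
  - by rewrite mevalB mevalC subr_ge0.
apply: contrapT => none.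
have /choice[ky kyP] j : exists ky : {k : nat & momvec R n k.*2},
    [/\ (maxn j K0 <= projT1 ky)%N, (uphalf m <= projT1 ky)%N,
        optimizer (feasQ A (projT1 ky)) (costQ xi) (projT2 ky)
      & 0 <= f.@[first_moments (projT2 ky)]].
  apply: contrapT => nj; apply: none; exists (maxn j K0) => k mk jk; split.
    exists (@point_moments R n k.*2 xs); apply: point_feas => //.
    by apply: leq_trans jk; rewrite leq_maxr.
  move=> y yopt; rewrite ltNge; apply/negP => ge0.
  by apply: nj; exists (existT _ k y).
pose k j := projT1 (ky j); pose y j : momvec R n (k j).*2 := projT2 (ky j).
have mk j : (uphalf m <= k j)%N by case: (kyP j).
have jk j : (j <= k j)%N.
  by case: (kyP j) => h _ _ _; apply: leq_trans h; rewrite leq_maxl.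
have Kk j : (K0 <= k j)%N.
  by case: (kyP j) => h _ _ _; apply: leq_trans h; rewrite leq_maxr.
have yF j : moment_feasible eqQ_polys (geQ_polys (vstar A)) (y j).
  by have [_ _ [yF _] _] := kyP j; rewrite -(vE _ (mk j) (Kk j)) -feasQE.
pose C := both_signs (geQ_polys (vstar A)) eqQ_polys.
have Cball : C (ballpoly R n) by left; left; apply: geQ_ball.
have [F [L [FF sF uL CL]]] := asymptotic_limit Cball (feasible_asymptotic jk yF).
have Lxi : L (polyof xi) <= (polyof xi).@[xs].
  apply: (cvgr_to_le (uL _)); apply: nearW => j.
  rewrite -(@pairing_point R n (k j).*2 xs).
    by have [_ _ [_ h] _] := kyP j; exact: h (point_feas (k j) (mk j) (Kk j)).
  apply: degree_le => //; rewrite (leq_trans (msize_sum _ _ _)) //.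
  apply/bigmax_leqP => a _; rewrite (leq_trans (msizeZ_le _ _)) // msizeX.
  exact: (bmdeg a).
have Lmin L' : is_state C L' -> (polyof xi).@[xs] <= L' (polyof xi).
  move=> CL'; have [x [xC xL']] := state_point (polyof xi) Cball CL'.
  apply: le_trans xL'; apply: xsle; exact: geQ_point.
have LxiE : L (polyof xi) = (polyof xi).@[xs].
  by apply: le_anti; rewrite Lxi Lmin.
have CL1 : is_state (fix_value C (polyof xi) (L (polyof xi))) L.
  apply: minimizing_state_definite => // L' CL'.
  by rewrite LxiE; apply: Lmin.
have Lpoint q : q.@[xs] <= L q.
  have [x [xC xL]] := state_point q (or_introl Cball) CL1.
  have [Sx fx] : simplex x /\ f.@[x] <= vstar A.
    by apply: geQ_point => g Cg; apply: xC; left.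
  have xxi : (polyof xi).@[x] = (polyof xi).@[xs].
    apply: le_anti; apply/andP; split; last exact: xsle.
    have := xC ((L (polyof xi))%:MP - polyof xi) (or_intror (or_intror erefl)).
    by rewrite mevalB mevalC subr_ge0 LxiE.
  suff -> : xs = x by [].
  apply/funext => i; apply/esym/uniq_xi.
    split=> // z Kz; rewrite !lincostE xxi; exact: xsle.
  by split=> // z Kz; rewrite !lincostE; apply: xsle.
have LX i : L 'X_i = xs i.
  have [Llin _ _ _] := CL; have := Lpoint 'X_i; have := Lpoint (- 'X_i).
  rewrite (linN Llin) mevalN mevalXU lerN2 => h1 h2.
  by apply: le_anti; rewrite h1 h2.
have : 0 <= f.@[xs].
  have uxs i : first_moments (y j) i @[j --> F] --> xs i by rewrite -LX; apply: uL.
  apply: (cvgr_to_ge (meval_cvg (q := f) FF uxs)); apply: nearW => j.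
  by case: (kyP j).
by rewrite leNgt (le_lt_trans fxs v0).
Qed.

End Programs.

Lemma copositive_vstar (R : realType) (m n : nat) (A : tensor R m n) :
  (0 < n)%N -> copositive A -> 0 <= vstar A.
Proof.
move=> n0 Acop; have [x [_ x0] [<- _]] := simplex_min A n0; exact: Acop.
Qed.

Lemma not_copositive_vstar (R : realType) (m n : nat) (A : tensor R m n) :
  (0 < m)%N -> (0 < n)%N -> ~ copositive A -> vstar A < 0.
Proof.
move=> m0 n0 nAcop; rewrite ltNge; apply/negP => v0; apply: nAcop => x x0.
pose s := \sum_i x i; have s0 : 0 <= s by apply: sumr_ge0.
have [s_eq0|s_neq0] := eqVneq s 0.
  have -> : (tform A).@[x] = (tform A).@[fun i => 0 * x i].
    congr meval; apply/funext => i; rewrite mul0r; apply/eqP.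
    have /eqP := s_eq0; rewrite psumr_eq0 // => /allP/(_ i).
    by rewrite mem_index_enum => /(_ isT).
  by rewrite tform_homog expr0n gtn_eqF // mul0r.
have sp : 0 < s by rewrite lt_def s_neq0.
have : 0 <= (tform A).@[fun i => s^-1 * x i].
  apply: le_trans v0 _; apply: vstar_le => //; split=> [|i].
    by rewrite -mulr_sumr mulVf.
  by rewrite mulr_ge0 // invr_ge0.
by rewrite tform_homog pmulr_rge0 // exprn_gt0 // invr_gt0.
Qed.

Theorem theorem3p2 (R : realType) (m n : nat) (hm : (0 < m)%N) (hn : (0 < n)%N)
    (A : tensor R m n) (hA : symmetric_tensor A) :
  (* (i) *)
  ((forall k : nat, (uphalf m <= k)%N ->
      feasP A k !=set0
      /\ exists y, optimizer (feasP A k) (costP A) y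
                   /\ costP A y = vmom A k)
   /\ exists K : nat, forall k : nat,
        (uphalf m <= k)%N -> (K <= k)%N -> vmom A k = vstar A)
  (* (ii) *)
  /\ (forall (xi : momvec R n m) (k : nat), (uphalf m <= k)%N ->
        feasQ A k !=set0 ->
        exists y, optimizer (feasQ A k) (costQ xi) y)
  (* (iii) *)
  /\ (copositive A -> forall xi : momvec R n m,
        algorithm_must_end A xi
          (fun s => exists k, s = DeclaredCopositive R n k /\ 0 <= vmom A k))
  (* (iv) *)
  /\ (~ copositive A ->
        almost_all (fun xi : momvec R n m =>
          algorithm_must_end A xi
            (fun s => exists k u,
               [/\ s = DeclaredNotCopositive k u, simplex u
                 & (tform A).@[u] < 0]))).
Proof.
split; [|split; [|split]].
- split=> [k mk|]; last exact: vmom_eq_vstar.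
  split; first exact: feasP_neq0.
  have [y yopt] := feasP_optimizer A hn k; exists y; split=> //.
  by rewrite /vmom (optval_optimizer yopt).
- by move=> xi k mk; apply: feasQ_optimizer.
- move=> Acop xi; have v0 := copositive_vstar hn Acop.
  have [K vE] := vmom_eq_vstar A hn.
  apply: (algorithm_ends (K := K)) => [k mk vk|k y mk yF|k mk Kk].
  + by exists k.
  + have [_ u0] := first_moments_simplex hm mk yF.
    by rewrite ltNge Acop.
  + by rewrite vE // ltNge v0.
- move=> nAcop; have v0 := not_copositive_vstar hm hn nAcop.
  apply: (almost_all_unique hm) => xi uniq_xi.
  have [K KP] := optimizers_eventually_negative hn uniq_xi v0.
  apply: (algorithm_ends (K := K)) => [k mk vk|k y mk yF yneg|k mk Kk _].
  + by have := le_trans vk (vmom_le_vstar A hn mk); rewrite leNgt v0.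
  + by exists k, (first_moments y); split=> //; apply: first_moments_simplex yF => //.
  + exact: KP.
Qed.
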